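(* Let $d\ge1$ and $1\le k\le d$ be integers, and for $x=(x_1,\dots,x_d)\in\mathbb{R}^d$ let $P_k(x):=(x_1,\dots,x_k,0,\dots,0)$ be the orthogonal projection onto the first $k$ coordinates. Let $T>0$ and $g_k(x):=-|P_k(x)|$. For $\varepsilon\in(0,1]$ let $\varphi^{k,\varepsilon}$ be the solution of $$-\partial_t\varphi^{k,\varepsilon}_t+\tfrac12|\nabla\varphi^{k,\varepsilon}_t|^2=\tfrac{\varepsilon}{2}\Delta\varphi^{k,\varepsilon}_t\quad\text{on }[0,T)\times\mathbb{R}^d,\qquad \varphi^{k,\varepsilon}_T=g_k,$$ and let $\varphi^{k,0}$ be the viscosity solution of $$-\partial_t\varphi^{k,0}_t+\tfrac12|\nabla\varphi^{k,0}_t|^2=0\quad\text{on }[0,T)\times\mathbb{R}^d,\qquad \varphi^{k,0}_T=g_k.$$ Then for every $t\in[0,T)$, as $\varepsilon\to0^+$, $$\varphi^{k,\varepsilon}_t(0)=\varphi^{k,0}_t(0)+\frac{k-1}{2}\,\varepsilon\log\varepsilon-\frac{k-1}{2}\,\varepsilon\log(T-t)-\varepsilon\log\frac{k\sqrt{\pi}}{2^{\frac{k-1}{2}}\,\Gamma\!\left(\frac k2+1\right)}+o(\varepsilon).$$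
   Context: $|\cdot|$ is the Euclidean norm and $\Gamma$ is the Euler Gamma function. Since $g_k$ is Lipschitz, the viscous equation has a unique classical ($\mathcal{C}^{1,2}$) solution with bounded gradient attaining $g_k$ continuously at time $T$, and the first-order equation has a unique viscosity solution (Lipschitz in $x$), namely the locally uniform limit of $\varphi^{k,\varepsilon}$ as $\varepsilon\to0$. *)

(* Defs.v *)
From HB Require Import structures.
From mathcomp Require Import all_boot all_order all_algebra.
From mathcomp Require Import all_classical all_reals all_analysis.

Set Implicit Arguments.
Unset Strict Implicit.
Unset Printing Implicit Defensive.

Import Order.TTheory GRing.Theory Num.Theory.
Import numFieldNormedType.Exports.

Local Open Scope classical_set_scope.
Local Open Scope ring_scope.

(* The library norm `|x| on 'rV[R]_d is the sup norm, hence this definition. *)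
Definition enorm (R : realType) (d : nat) (x : 'rV[R]_d) : R :=
  Num.sqrt (\sum_(i < d) x ord0 i ^+ 2).

Definition proj_first (R : realType) (d k : nat) (x : 'rV[R]_d) : 'rV[R]_d :=
  \row_(i < d) (if (i < k)%N then x ord0 i else 0).

Definition gterm (R : realType) (d k : nat) (x : 'rV[R]_d) : R :=
  - enorm (proj_first k x).

Definition Gamma (R : realType) (s : R) : R :=
  \int[lebesgue_measure]_(x in `]0, +oo[) (x `^ (s - 1) * expR (- x)).

Definition cyl (R : realType) (d : nat) (T : R) : set (R * 'rV[R]_d) :=
  `[0, T[%classic `*` setT.

Definition ccyl (R : realType) (d : nat) (T : R) : set (R * 'rV[R]_d) :=
  `[0, T]%classic `*` setT.

Arguments cyl {R} d T _.
Arguments ccyl {R} d T _.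

Definition uncur (R : realType) (d : nat) (f : R -> 'rV[R]_d -> R)
  (p : R * 'rV[R]_d) : R := f p.1 p.2.

Definition tquot (R : realType) (d : nat) (f : R -> 'rV[R]_d -> R)
  (t : R) (x : 'rV[R]_d) (s : R) : R := (s - t)^-1 * (f s x - f t x).

(* Time derivative relative to [0, T[ : the right derivative at t = 0 and the
   usual derivative for 0 < t < T; values of f at negative times, which are
   meaningless, play no role. *)
Definition tderivable (R : realType) (d : nat) (T : R)
    (f : R -> 'rV[R]_d -> R) (t : R) (x : 'rV[R]_d) : Prop :=
  cvg (tquot f t x s @[s --> within `[0, T[ t^']).

Definition tderive (R : realType) (d : nat) (T : R)
    (f : R -> 'rV[R]_d -> R) (t : R) (x : 'rV[R]_d) : R :=
  lim (tquot f t x s @[s --> within `[0, T[ t^']).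

Definition basis_vec (R : realType) (d : nat) (i : 'I_d) : 'rV[R]_d :=
  delta_mx ord0 i.

Definition pderive (R : realType) (d : nat) (i : 'I_d)
    (f : R -> 'rV[R]_d -> R) (t : R) (x : 'rV[R]_d) : R :=
  'D_(basis_vec R i) (f t) x.

Definition pderivable (R : realType) (d : nat) (i : 'I_d)
    (f : R -> 'rV[R]_d -> R) (t : R) (x : 'rV[R]_d) : Prop :=
  derivable (f t) x (basis_vec R i).

Definition grad (R : realType) (d : nat) (f : R -> 'rV[R]_d -> R)
  (t : R) (x : 'rV[R]_d) : 'rV[R]_d := \row_(i < d) pderive i f t x.

Definition laplacian (R : realType) (d : nat) (f : R -> 'rV[R]_d -> R)
  (t : R) (x : 'rV[R]_d) : R := \sum_(i < d) pderive i (pderive i f) t x.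

Definition C11 (R : realType) (d : nat) (T : R)
    (f : R -> 'rV[R]_d -> R) : Prop :=
  [/\ {within cyl d T, continuous (uncur f)},
      forall t x, 0 <= t < T -> tderivable T f t x,
      {within cyl d T, continuous (uncur (tderive T f))},
      forall i t x, 0 <= t < T -> pderivable i f t x &
      forall i, {within cyl d T, continuous (uncur (pderive i f))}].

Definition C12 (R : realType) (d : nat) (T : R)
    (f : R -> 'rV[R]_d -> R) : Prop :=
  [/\ C11 T f,
      forall i j t x, 0 <= t < T -> pderivable j (pderive i f) t x &
      forall i j, {within cyl d T, continuous (uncur (pderive j (pderive i f)))}].

Definition classical_solution (R : realType) (d : nat) (T eps : R)
    (g : 'rV[R]_d -> R) (u : R -> 'rV[R]_d -> R) : Prop :=
  [/\ C12 T u,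
      exists C : R, forall t x, 0 <= t < T -> enorm (grad u t x) <= C,
      {within ccyl d T, continuous (uncur u)},
      forall x, u T x = g x &
      forall t x, 0 <= t < T ->
        - tderive T u t x + 2^-1 * enorm (grad u t x) ^+ 2
          = eps / 2 * laplacian u t x].

(* Test functions are C^1 on [0, T[ x R^d and the extrema are local relative
   to [0, T[ x R^d.  The equation -u_t + |Du|^2/2 = 0 runs backward from time
   T; the inequalities have the signs of the limit of
   -u_t + |Du|^2/2 = (eps/2) Lap u as eps decreases to 0. *)
Definition viscosity_subsolution (R : realType) (d : nat) (T : R)
    (u : R -> 'rV[R]_d -> R) : Prop :=
  forall psi : R -> 'rV[R]_d -> R, C11 T psi ->
  forall (t : R) (x : 'rV[R]_d), 0 <= t < T ->
  (\forall p \near within (cyl d T) (nbhs (t, x)),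
     u p.1 p.2 - psi p.1 p.2 <= u t x - psi t x) ->
  - tderive T psi t x + 2^-1 * enorm (grad psi t x) ^+ 2 <= 0.

Definition viscosity_supersolution (R : realType) (d : nat) (T : R)
    (u : R -> 'rV[R]_d -> R) : Prop :=
  forall psi : R -> 'rV[R]_d -> R, C11 T psi ->
  forall (t : R) (x : 'rV[R]_d), 0 <= t < T ->
  (\forall p \near within (cyl d T) (nbhs (t, x)),
     u t x - psi t x <= u p.1 p.2 - psi p.1 p.2) ->
  0 <= - tderive T psi t x + 2^-1 * enorm (grad psi t x) ^+ 2.

Definition viscosity_solution (R : realType) (d : nat) (T : R)
    (g : 'rV[R]_d -> R) (u : R -> 'rV[R]_d -> R) : Prop :=
  [/\ {within ccyl d T, continuous (uncur u)},
      exists L : R, forall t x y, 0 <= t <= T ->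
        `|u t x - u t y| <= L * enorm (x - y),
      forall x, u T x = g x,
      viscosity_subsolution T u &
      viscosity_supersolution T u].

(* Main.v *)
Require Import Defs.
From HB Require Import structures.
From mathcomp Require Import all_boot all_order all_algebra.
From mathcomp Require Import all_classical all_reals all_analysis.
From mathcomp Require Import ring lra zify.

Set Implicit Arguments.
Unset Strict Implicit.
Unset Printing Implicit Defensive.

Import Order.TTheory GRing.Theory Num.Theory.
Import numFieldNormedType.Exports.

Local Open Scope classical_set_scope.
Local Open Scope ring_scope.

(** Write [tau = T - t] and [w = exp(- phi / eps)].  The Cole-Hopf transform
    turns the viscous equation into the backward heat equation
    [w_t + (eps / 2) Lap w = 0] with final value [exp(r / eps)], where [r] is the
    norm of the first [k] coordinates.  Everything rests on two observations.

    - Since [exp(y) <= exp(y) + exp(-y) <= exp(y) + 1] for [y >= 0], and constants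
      solve the heat equation, [w] is within 1 of the solution [W] whose final
      value is [2 cosh(r / eps)].  As [w(t, 0)] grows exponentially in [1 / eps],
      the error 1 is invisible in the expansion.
    - [cosh(r / eps)] is a power series in [r^2], and on polynomials in [r^2] the
      heat flow is a finite sum: with [L q = 2 X q'' + k q'], the function
      [sum_j (eps tau)^j / j! (L^j q)(r^2)] is an exact solution
      ([heat_poly_heat]).  This replaces Gaussian integrals in dimension [k],
      and at the origin it gives [W(t, 0) = 2 F_k(tau / eps)] with
      [F_k(z) = sum_m k (k + 2) ... (k + 2 m - 2) / (2 m)! z^m]
      ([heat_poly_cosh0]).

    The comparison of [w] with truncations of [W] is the maximum principle on
    [0, T] x R^d with a barrier growing faster than [w] ([heat_compare]); the
    growth of [w] is controlled by the bounded gradient of [phi].  The outcome is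
    [2 F_k(tau / eps) - 1 <= w(t, 0) <= 2 F_k(tau / eps)] ([cole_hopf_bounds]).

    The series [F_k] is the confluent hypergeometric function
    [1F1(k/2; 1/2; z/2)].  Coefficientwise,
    [z F_k <= k F_(k+2) <= (2 k - 1 + z) F_k] ([kummer_shift]), hence
    [F_(k+2) / F_k] is equivalent to [z / k] and the asymptotics reduce to
    [F_1(z) = exp(z / 2)] and to [F_2], which is expressed by the Gauss primitive
    ([kummer2]).  The same two-step recursion is satisfied by
    [Gamma(k / 2 + 1)], and this produces the constant of the statement
    ([kummer_ratio_cvg]).

    For the first-order equation the value at the origin is [- tau / 2].  The
    functions [- x_0 - tau / 2] and [- sqrt(eta^2 + r^2) - tau / 2] lie, at time
    [T], above and below [- r]; after a quadratic perturbation that makes them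
    strict and confines the extrema they are admissible test functions, so that
    they bound the viscosity solution directly ([hopf_lax_le], [hopf_lax_ge]). *)

(** * The Gauss primitive and values of Gamma at half-integers *)

Lemma is_derive_continuous (R : realType) (f : R -> R) (x d : R) :
  is_derive x 1 f d -> f y @[y --> x] --> f x.
Proof.
by move=> [df _]; apply: differentiable_continuous; apply/derivable1_diffP.
Qed.

Lemma is_derive_expn (R : realType) (n : nat) (x : R) :
  is_derive x 1 (fun y => y ^+ n) (n%:R * x ^+ n.-1).
Proof.
have -> : (fun y : R => y ^+ n) = id ^+ n.
  by apply/funext => y; rewrite exprfctE.
have := @is_deriveX R R id n x 1 1 (is_derive_id x 1) => /is_derive_eq; apply.
by rewrite /GRing.scale /= mulr1.
Qed.

Section GaussPrimitive.
Context {R : realType}.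
Implicit Types x p A : R.

Definition gauss_int : R -> R := @gauss_integral_proof.integral0_gauss R.

Lemma gauss_int0 : gauss_int 0 = 0.
Proof.
by rewrite /gauss_int /gauss_integral_proof.integral0_gauss set_itv1 Rintegral_set1.
Qed.

Lemma gauss_integrable A :
  lebesgue_measure.-integrable `[0, A] (EFin \o @gauss_fun R).
Proof.
apply: continuous_compact_integrable; first exact: segment_compact.
by apply: continuous_subspaceT; exact: continuous_gauss_fun.
Qed.

Lemma is_derive_gauss_int x : 0 < x -> is_derive x 1 gauss_int (expR (- x ^+ 2)).
Proof.
move=> x0; have x1 : x < x + 1 by rewrite ltrDl.
have [d e] := continuous_FTC1_closed x1 (gauss_integrable (x + 1)) x0
  (@continuous_gauss_fun _ x).
by apply: DeriveDef => //; rewrite -derive1E e.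
Qed.

Lemma gauss_int_within A : 0 <= A -> {within `[0, A], continuous gauss_int}.
Proof.
by move=> A0; apply: parameterized_integral_continuous => //; exact: gauss_integrable.
Qed.

Lemma gauss_int_cvg0 : gauss_int x @[x --> 0^'+] --> (0 : R).
Proof.
have /(continuous_within_itvP _ ltr01)[_ + _] := gauss_int_within ler01.
by rewrite gauss_int0.
Qed.

Lemma gauss_int_cvgy : gauss_int x @[x --> +oo] --> (Num.sqrt pi / 2 : R).
Proof.
have h : Num.sqrt (gauss_int x ^+ 2) @[x --> +oo] --> Num.sqrt (pi / 4 : R).
  by apply: continuous_cvg; [exact: sqrt_continuous|
    exact: gauss_integral_proof.cvg_integral0_gauss_sqr].
have -> : Num.sqrt pi / 2 = Num.sqrt (pi / 4) :> R.
  rewrite sqrtrM ?pi_ge0// sqrtrV// (_ : 4 = 2 ^+ 2) ?sqrtr_sqr ?ger0_norm//.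
  by rewrite expr2 -natrM.
apply: cvg_trans h; apply: near_eq_cvg; apply: nearW => x.
by rewrite sqrtr_sqr ger0_norm// gauss_integral_proof.integral0_gauss_ge0.
Qed.

End GaussPrimitive.

(** [exp(x) >= x^(n+1) / (n+1)!] bounds the product by a multiple of [1 / x]. *)
Lemma powR_expRN_cvgy (R : realType) (p : R) :
  x `^ p * expR (- x) @[x --> +oo] --> (0 : R).
Proof.
pose n := Num.bound p.
have pn : p <= n%:R.
  have [p0|/ltW p0] := leP 0 p; last exact: le_trans p0 (ler0n _ _).
  by rewrite ltW//; exact: archi_boundP.
have bound x : 1 <= x -> x `^ p * expR (- x) <= n.+1`!%:R / x.
  move=> x1; have x0 : 0 < x by lra.
  rewrite expRN ler_pdivlMr// mulrAC ler_pdivrMr ?expR_gt0//.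
  apply: (@le_trans _ _ (x ^+ n.+1)).
    rewrite exprSr -powR_mulrn ?(ltW x0)//; apply: ler_wpM2r; first exact: ltW.
    exact: ler_powR.
  have := expR_ge1Dxn n (ltW x0).
  rewrite -ler_pdivrMl ?ltr0n ?fact_gt0// mulrC => h; apply: le_trans h.
  by rewrite lerDr.
apply: (@squeeze_cvgr _ _ _ _ (fun=> 0) (fun x => n.+1`!%:R * x^-1)).
- near=> x; rewrite mulr_ge0 ?powR_ge0 ?expR_ge0//= bound//.
- exact: cvg_cst.
- rewrite -[X in _ --> X](mulr0 n.+1`!%:R); apply: cvgMl_tmp.
  apply/gtr0_cvgV0; last exact: cvg_id.
  by near=> x.
Unshelve. all: end_near. Qed.

(** An antiderivative [G] of the Gamma integrand [x^p exp(-x)] that vanishes at [0]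
    and tends to [l] at infinity.  Working with antiderivatives lets the functional
    equation of Gamma be proved by pointwise differentiation, the improper
    integral being evaluated only once, in [GammaE]. *)
Definition gamma_primitive (R : realType) (p l : R) := exists G : R -> R,
  [/\ G x @[x --> +oo%R] --> l, G @ 0^'+ --> (0 : R), G 0 = 0 &
      forall x : R, 0 < x -> is_derive x 1 G (x `^ p * expR (- x))].

Lemma is_derive_expRN (R : realType) (x : R) :
  is_derive x 1 (fun x => expR (- x)) (- expR (- x)).
Proof.
have := @is_derive1_comp R expR -%R x _ _ (is_derive_expR _) (is_deriveNid _ _).
by rewrite mulrN1.
Qed.

Lemma powR_expRN_cvg0 (R : realType) (p : R) : 0 < p ->
  x `^ p * expR (- x) @[x --> 0^'+] --> (0 : R).
Proof.
move=> p0; rewrite -[X in _ --> X](mul0r (expR (- 0))).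
apply: cvgM; first exact: powR_cvg0.
by apply: cvg_at_right_filter; apply: is_derive_continuous (is_derive_expRN _).
Qed.

Lemma is_derive_powR_expRN (R : realType) (p x : R) : 0 < x ->
  is_derive x 1 (fun x => x `^ p * expR (- x))
    (p * x `^ (p - 1) * expR (- x) - x `^ p * expR (- x)).
Proof.
move=> x0; have h1 := is_derive1_powR p x0; have h2 := is_derive_expRN x.
have := is_deriveM h1 h2 => /is_derive_eq; apply.
by rewrite /GRing.scale /=; ring.
Qed.

(** Integration by parts: if [G] is an antiderivative for [p] then
    [(p + 1) G - x^(p+1) exp(-x)] is one for [p + 1]. *)
Lemma gamma_primitive_succ (R : realType) (p l : R) : 0 <= p ->
  gamma_primitive p l -> gamma_primitive (p + 1) ((p + 1) * l).
Proof.
move=> p0 [G [Gy G0 GE dG]].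
exists (fun x => (p + 1) * G x - x `^ (p + 1) * expR (- x)); split.
- rewrite -[X in _ --> X]subr0; apply: cvgB; last exact: powR_expRN_cvgy.
  exact: cvgMl_tmp.
- rewrite -[X in _ --> X]subr0; apply: cvgB.
    by rewrite -[X in _ --> X](mulr0 (p + 1)); exact: cvgMl_tmp.
  by apply: powR_expRN_cvg0; lra.
- by rewrite GE powR0 ?mul0r ?mulr0 ?subr0//; apply/eqP; lra.
- move=> x x0; have h1 := is_deriveZ (p + 1) (dG x x0).
  have h2 := is_derive_powR_expRN (p + 1) x0.
  have := is_deriveB h1 h2 => /is_derive_eq; apply.
  by rewrite /GRing.scale /= addrK; ring.
Qed.

Lemma gamma_primitive0 (R : realType) : gamma_primitive (0 : R) 1.
Proof.
exists (fun x => 1 - expR (- x)); split.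
- rewrite -[X in _ --> X]subr0; apply: cvgB; first exact: cvg_cst.
  exact: cvgr_expR.
- have e0 : 1 - expR (- 0) = 0 :> R by rewrite oppr0 expR0 subrr.
  rewrite -[X in _ --> X]e0; apply: cvgB; first exact: cvg_cst.
  by apply: cvg_at_right_filter; apply: is_derive_continuous (is_derive_expRN _).
- by rewrite oppr0 expR0 subrr.
- move=> x x0; rewrite powRr0 mul1r.
  have := is_deriveB (is_derive_cst (1 : R) x 1) (is_derive_expRN x).
  by move=> /is_derive_eq; apply; rewrite sub0r opprK.
Qed.

Lemma cvg_sqrty (R : realType) : Num.sqrt x @[x --> +oo] --> (+oo : set_system R).
Proof.
apply/cvgryPge => A; near=> x.
have A2 : A ^+ 2 <= x by near: x; apply: nbhs_pinfty_ge; rewrite num_real.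
by rewrite (le_trans (ler_norm A))// -sqrtr_sqr ler_wsqrtr.
Unshelve. all: end_near. Qed.

(** The substitution [x = y^2] followed by an integration by parts reduces
    [Gamma(3/2)] to the Gauss integral, with antiderivative
    [gauss_int (sqrt x) - sqrt x exp(-x)]. *)
Lemma gamma_primitive_half (R : realType) :
  gamma_primitive (2^-1 : R) (Num.sqrt pi / 2).
Proof.
exists (fun x => gauss_int (Num.sqrt x) - x `^ (2^-1) * expR (- x)); split.
- rewrite -[X in _ --> X]subr0; apply: cvgB; last exact: powR_expRN_cvgy.
  exact: cvg_comp (@cvg_sqrty R) gauss_int_cvgy.
- rewrite -[X in _ --> X]subr0; apply: cvgB; last exact: powR_expRN_cvg0.
  apply: cvg_comp gauss_int_cvg0.
  move=> A /nbhs_ballP[e e0 eA]; change (\forall x \near (0:R)^'+, A (Num.sqrt x)).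
  near=> x; have x0 : 0 < x by near: x; exact: nbhs_right_gt.
  apply: eA => /=; last by rewrite sqrtr_gt0.
  rewrite /ball/= sub0r normrN ger0_norm ?sqrtr_ge0//.
  rewrite -[e](@ger0_norm _ e) ?ltW// -sqrtr_sqr ltr_sqrt ?exprn_gt0//.
  by near: x; apply: nbhs_right_lt; rewrite exprn_gt0.
- by rewrite sqrtr0 gauss_int0 powR0 ?mul0r ?subr0.
- move=> x x0; have s0 : 0 < Num.sqrt x by rewrite sqrtr_gt0.
  have h1 := is_derive1_comp (is_derive_gauss_int s0) (is_derive1_sqrt x0).
  have h2 := is_derive_powR_expRN (2^-1) x0.
  have := is_deriveB h1 h2 => /is_derive_eq; apply.
  rewrite sqr_sqrtr ?ltW// (_ : 2^-1 - 1 = - 2^-1 :> R); last by lra.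
  rewrite powRN powR12_sqrt ?ltW// invfM opprB.
  by field; rewrite gt_eqF.
Unshelve. all: end_near. Qed.

Lemma GammaE (R : realType) (p l : R) : 0 < p ->
  gamma_primitive p l -> Gamma (p + 1) = l.
Proof.
move=> p0 [G [Gy G0 GE dG]].
have cf x : 0 < x -> {for x, continuous (fun x => x `^ p * expR (- x))}.
  by move=> x0; apply: is_derive_continuous (is_derive_powR_expRN p x0).
have cw : {within `[0, +oo[, continuous (fun x => x `^ p * expR (- x))}.
  apply/continuous_within_itvcyP; split.
    by move=> x; rewrite in_itv/= andbT => /cf.
  by rewrite powR0 ?gt_eqF// mul0r; exact: powR_expRN_cvg0.
rewrite /Gamma addrK /Rintegral integral_itv_obnd_cbnd; last first.
  apply/measurable_realfun.measurable_EFinP.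
  apply: measurable_realfun.open_continuous_measurable_fun => //.
  by move=> x; rewrite inE/= in_itv/= andbT; exact: cf.
rewrite -/(Rintegral _ _ _).
rewrite (@Rintegral_ge0_continuous_FTC2y _ _ G 0 l) ?GE ?subr0//.
- by move=> x x0; rewrite mulr_ge0 ?powR_ge0 ?expR_ge0.
- by move=> x /dG[].
- by move=> x; rewrite in_itv/= andbT => x0; rewrite derive1E; have [_] := dG x x0.
Qed.

(** * Asymptotics of a confluent hypergeometric series *)

Section KummerSeries.
Context {R : realType}.
Implicit Types (k m N : nat) (z A x : R).

(** The coefficients [k (k + 2) ... (k + 2 m - 2) / (2 m)!], written as a product so
    that consecutive ones differ by one factor; [k (k + 2) ... (k + 2 m - 2)] is the
    moment of order [2 m] of the norm of a standard Gaussian vector of dimension [k]. *)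
Definition kummer_coef k m : R :=
  \prod_(i < m) ((k + i.*2)%:R / (i.*2.+1 * i.*2.+2)%:R).

Lemma kummer_coefS k m :
  kummer_coef k m.+1 = kummer_coef k m * ((k + m.*2)%:R / (m.*2.+1 * m.*2.+2)%:R).
Proof. by rewrite /kummer_coef big_ord_recr. Qed.

Lemma kummer_coef0 k : kummer_coef k 0 = 1. Proof. by rewrite /kummer_coef big_ord0. Qed.

Lemma kummer_coef_ge0 k m : 0 <= kummer_coef k m.
Proof. by apply: prodr_ge0 => i _; rewrite divr_ge0. Qed.

Lemma kummer_coef_shift k m : k%:R * kummer_coef k.+2 m = (k + m.*2)%:R * kummer_coef k m.
Proof.
elim: m => [|m IH]; first by rewrite !kummer_coef0 addn0.
rewrite !kummer_coefS mulrA IH.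
rewrite doubleS !addnS; set D := (_ * _)%N%:R^-1; ring.
Qed.

Definition kummer_term k z m : R := kummer_coef k m * z ^+ m.
Definition kummer_sum k z : R^nat := series (kummer_term k z).
(** The function [1F1(k/2; 1/2; z/2)]. *)
Definition kummer k z : R := limn (kummer_sum k z).

Lemma kummer_term_ge0 k z m : 0 <= z -> 0 <= kummer_term k z m.
Proof. by move=> z0; rewrite mulr_ge0 ?kummer_coef_ge0 ?exprn_ge0. Qed.

Lemma kummer_sum_ndecr k z : 0 <= z -> nondecreasing_seq (kummer_sum k z).
Proof. by move=> z0; apply: nondecreasing_series => n _ _; exact: kummer_term_ge0. Qed.

(** Reduces to [(2 m + 1) (2 m + 2) <= (k + 2 m) (k + 2 m + 2)]. *)
Lemma kummer_term_shift_ge k z m : (0 < k)%N -> 0 <= z ->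
  z * kummer_term k z m <= k%:R * kummer_term k.+2 z m.+1.
Proof.
move=> k0 z0; rewrite /kummer_term mulrCA -exprS mulrA kummer_coef_shift ler_wpM2r ?exprn_ge0//.
rewrite kummer_coefS mulrCA ler_peMr ?kummer_coef_ge0// mulrA -natrM ler_pdivlMr ?ltr0n//.
rewrite mul1r ler_nat; nia.
Qed.

(** Together with [kummer_term_shift_ge] this is a one-sided form of the contiguity
    relation of [1F1]; it reduces to [0 <= (k - 1) (k - 2)]. *)
Lemma kummer_term_shift_le k z m : (0 < k)%N -> 0 <= z ->
  k%:R * kummer_term k.+2 z m.+1 <= (k.*2.-1)%:R * kummer_term k z m.+1 + z * kummer_term k z m.
Proof.
move=> k0 z0; rewrite /kummer_term [z * _]mulrCA -exprS !mulrA kummer_coef_shift -mulrDl.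
rewrite ler_wpM2r ?exprn_ge0// -lerBlDl -mulrBl kummer_coefS.
set D := (m.*2.+1 * m.*2.+2)%:R; have D0 : 0 < D by rewrite ltr0n.
rewrite mulrCA -[leRHS]mulr1 ler_wpM2l ?kummer_coef_ge0// mulrA ler_pdivrMr// mul1r /D.
have -> : k.*2.-1%:R = 2 * k%:R - 1 :> R by rewrite -subn1 natrB ?double_gt0// -muln2 natrM mulrC.
have e2 : (m.*2)%:R = 2 * m%:R :> R by rewrite -natrM mul2n.
have -> : (k + m.+1.*2)%:R = k%:R + 2 * m%:R + 2 :> R.
  by rewrite doubleS -addn2 addnA !natrD e2.
have -> : (m.*2.+1 * m.*2.+2)%:R = (2 * m%:R + 1) * (2 * m%:R + 2) :> R.
  by rewrite -addn2 -addn1 natrM !natrD e2.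
rewrite natrD e2.
have [->|k2] := eqVneq k 1%N; first by lra.
have kk : 2 <= k%:R :> R by rewrite ler_nat; lia.
have mm : 0 <= m%:R :> R by []. nra.
Qed.

Lemma kummer_sum_shift_ge k z N : (0 < k)%N -> 0 <= z ->
  z * kummer_sum k z N <= k%:R * kummer_sum k.+2 z N.+1.
Proof.
move=> k0 z0; rewrite /kummer_sum /series /= big_nat_recl//= mulrDr.
apply: ler_wpDl; first by rewrite mulr_ge0 ?kummer_term_ge0.
rewrite !mulr_sumr; apply: ler_sum => i _; exact: kummer_term_shift_ge.
Qed.

Lemma kummer_sum_shift_le k z N : (0 < k)%N -> 0 <= z ->
  k%:R * kummer_sum k.+2 z N.+1 <= (k.*2.-1)%:R * kummer_sum k z N.+1 + z * kummer_sum k z N.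
Proof.
move=> k0 z0; rewrite /kummer_sum /series /= !big_nat_recl//= !mulrDr -addrA lerD//.
  rewrite /kummer_term !kummer_coef0 !expr0 !mulr1 ler_nat; lia.
rewrite !mulr_sumr -big_split; apply: ler_sum => i _; exact: kummer_term_shift_le.
Qed.

Lemma kummer_term1 z m : kummer_term 1 z m = exp_coeff (z / 2) m.
Proof.
rewrite /kummer_term /exp_coeff /= expr_div_n [RHS]mulrAC -[RHS]mulrA mulrC; congr (_ * _).
elim: m => [|m IH]; first by rewrite kummer_coef0 expr0 fact0 invr1 mulr1.
rewrite kummer_coefS IH factS exprS !natrM.
have -> : (1 + m.*2)%:R = m.*2.+1%:R :> R by rewrite add1n.
have -> : m.*2.+2%:R = 2 * m.+1%:R :> R by rewrite -natrM mul2n doubleS.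
have ? : m.*2.+1%:R != 0 :> R by rewrite pnatr_eq0.
have ? : m.+1%:R != 0 :> R by rewrite pnatr_eq0.
have ? : m`!%:R != 0 :> R by rewrite pnatr_eq0 -lt0n fact_gt0.
have ? : (2 ^+ m != 0 :> R) by rewrite expf_neq0.
by field; rewrite !nat1r; apply/and4P.
Qed.

Lemma kummer_sum1_cvg z : kummer_sum 1 z @ \oo --> expR (z / 2).
Proof.
have -> : kummer_sum 1 z = series (exp_coeff (z / 2)).
  by apply/funext => n; apply: eq_bigr => i _; rewrite kummer_term1.
exact: is_cvg_series_exp_coeff.
Qed.

Lemma kummer_sum_le k l z N : (k <= l)%N -> 0 <= z -> kummer_sum k z N <= kummer_sum l z N.
Proof.
move=> kl z0; rewrite /kummer_sum /series /=; apply: ler_sum => m _.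
rewrite /kummer_term ler_wpM2r ?exprn_ge0// /kummer_coef; apply: ler_prod => i _.
rewrite divr_ge0//= ler_wpM2r ?invr_ge0// ler_nat leq_add2r//.
Qed.

(** The partial sums increase, and [kummer_sum_shift_le] transports a bound from [k] to
    [k + 2].  It starts from [k = 1], an exponential series; [k = 2] is dominated by
    [k = 3]. *)
Lemma kummer_sum_is_cvg k z : (0 < k)%N -> 0 <= z -> cvgn (kummer_sum k z).
Proof.
move=> k0 z0; suff [M hM] : exists M, forall N, kummer_sum k z N <= M.
  by apply: nondecreasing_is_cvgn; [exact: kummer_sum_ndecr|exists M => _ [N _ <-]].
have step l : (0 < l)%N -> (exists M, forall N, kummer_sum l z N <= M) ->
    exists M, forall N, kummer_sum l.+2 z N <= M.
  move=> l0 [M hM]; exists (l%:R^-1 * ((l.*2.-1)%:R * M + z * M)) => N.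
  apply: (le_trans (kummer_sum_ndecr l.+2 z0 (leqnSn N))).
  rewrite ler_pdivlMl ?ltr0n//; apply: (le_trans (kummer_sum_shift_le _ l0 z0)).
  by rewrite lerD// ler_wpM2l.
have b1 : exists M, forall N, kummer_sum 1 z N <= M.
  exists (expR (z / 2)) => N; rewrite -(cvg_lim (@Rhausdorff R) (@kummer_sum1_cvg z)).
  apply: nondecreasing_cvgn_le; first exact: kummer_sum_ndecr.
  by apply/cvg_ex; exists (expR (z / 2)); exact: (@kummer_sum1_cvg z).
have b2 : exists M, forall N, kummer_sum 2 z N <= M.
  have [M hM] := step 1%N isT b1; exists M => N.
  by apply: (le_trans _ (hM N)); exact: kummer_sum_le.
move: k0; elim/ltn_ind: k => -[|[|[|k]]]// IH _.
by apply: step => //; exact: IH.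
Qed.

Lemma kummer_shift k z : (0 < k)%N -> 0 <= z ->
  z * kummer k z <= k%:R * kummer k.+2 z <= ((k.*2.-1)%:R + z) * kummer k z.
Proof.
move=> k0 z0; have c1 := kummer_sum_is_cvg k0 z0.
have c2 : kummer_sum k.+2 z N @[N --> \oo] --> kummer k.+2 z by exact: kummer_sum_is_cvg.
have {}c2 : kummer_sum k.+2 z N.+1 @[N --> \oo] --> kummer k.+2 z.
  by have := c2; rewrite -cvg_shiftS.
have c1s : kummer_sum k z N.+1 @[N --> \oo] --> kummer k z.
  by have := c1; rewrite -cvg_shiftS.
have kc2 : k%:R * kummer_sum k.+2 z N.+1 @[N --> \oo] --> k%:R * kummer k.+2 z.
  exact: cvgMl_tmp.
have zc1 : z * kummer_sum k z N @[N --> \oo] --> z * kummer k z by exact: cvgMl_tmp.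
apply/andP; split.
  by apply: ler_cvg_to zc1 kc2 _; apply: nearW => N; exact: kummer_sum_shift_ge.
rewrite mulrDl; apply: ler_cvg_to kc2 (cvgD (cvgMl_tmp c1s) zc1) _.
by apply: nearW => N; exact: kummer_sum_shift_le.
Qed.

(** With [S_N(a)] the partial sums of [sum_m a^(2m+1) / (2m+1)!!] one has
    [S_N' = 1 + a S_N - (last term)], so [exp(-a^2/2) S_N(a)] is, up to a term
    that vanishes as [N] grows, a primitive of [exp(-a^2/2)].  The variable is rescaled by
    [sqrt 2] so that the primitive is the one of [exp(-b^2)]. *)
Lemma kummer2 A : 0 < A ->
  kummer 2 (A ^+ 2) =
  1 + A * expR (A ^+ 2 / 2) * (Num.sqrt 2 * gauss_int (A / Num.sqrt 2)).
Proof.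
move=> A0; pose B := A / Num.sqrt 2.
have s20 : 0 < Num.sqrt 2 :> R by rewrite sqrtr_gt0.
have s22 : Num.sqrt 2 ^+ 2 = 2 :> R by rewrite sqr_sqrtr.
have B0 : 0 < B by rewrite divr_gt0.
have AB : A = Num.sqrt 2 * B by rewrite /B mulrC divfK// gt_eqF.
pose S N (a : R) := \sum_(m < N) kummer_coef 2 m.+1 * a ^+ m.*2.+1.
have cE m : kummer_coef 2 m.+1 * m.*2.+1%:R = kummer_coef 2 m.
  rewrite kummer_coefS natrM add2n -!mulrA [X in _ * X](_ : _ = 1) ?mulr1//.
  set p := m.*2.+1%:R; set q := m.*2.+2%:R.
  have [p0 q0] : p != 0 /\ q != 0 :> R by rewrite !pnatr_eq0.
  by field; apply/andP.
have SE N a : kummer_sum 2 (a ^+ 2) N.+1 = 1 + a * S N a.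
  rewrite /kummer_sum /series /= big_nat_recl//= /kummer_term kummer_coef0 expr0 mulr1; congr (_ + _).
  rewrite big_mkord /S mulr_sumr; apply: eq_bigr => m _.
  by rewrite -exprM mulrCA -exprS mul2n doubleS.
have dS N (a : R) : is_derive a 1 (S N) (kummer_sum 2 (a ^+ 2) N).
  elim: N => [|N IH].
    rewrite /kummer_sum /series /= big_nil (_ : S 0%N = cst 0); first exact: is_derive_cst.
    by apply/funext => x; rewrite /S big_ord0.
  have -> : S N.+1 = S N + kummer_coef 2 N.+1 *: (fun x : R => x ^+ N.*2.+1).
    by apply/funext => x; rewrite /S big_ord_recr.
  have h := is_derive_expn N.*2.+1 a.
  have := is_deriveD IH (is_deriveZ (kummer_coef 2 N.+1) h) => /is_derive_eq; apply.
  rewrite /kummer_sum /series /= [in RHS]big_nat_recr//=; congr (_ + _).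
  by rewrite /kummer_term -[kummer_coef 2 N]cE /GRing.scale /= -exprM mul2n mulrA.
pose E (b : R) := expR (- b ^+ 2).
have dE (b : R) : is_derive b 1 E (- (2 * b) * E b).
  have h := is_deriveN (is_derive_expn 2 b).
  have := @is_derive1_comp R expR (fun b => - b ^+ 2) b _ _ (is_derive_expR _) h.
  by move=> /is_derive_eq; apply; rewrite expr1 -/(E b); ring.
pose D N b := E b * S N (Num.sqrt 2 * b) - Num.sqrt 2 * gauss_int b.
have dES N (b : R) : is_derive b 1 (fun b => E b * S N (Num.sqrt 2 * b))
    (Num.sqrt 2 * E b * (1 - kummer_term 2 ((Num.sqrt 2 * b) ^+ 2) N)).
  have h1 : is_derive b 1 (fun b : R => Num.sqrt 2 * b) (Num.sqrt 2).
    have := is_deriveZ (Num.sqrt 2) (is_derive_id b (1 : R)).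
    by move=> /is_derive_eq; apply; rewrite /GRing.scale /= mulr1.
  have h2 := is_derive1_comp (dS N (Num.sqrt 2 * b)) h1.
  have := is_deriveM (dE b) h2 => /is_derive_eq; apply.
  have e1 : kummer_sum 2 ((Num.sqrt 2 * b) ^+ 2) N =
    1 + Num.sqrt 2 * b * S N (Num.sqrt 2 * b) - kummer_term 2 ((Num.sqrt 2 * b) ^+ 2) N.
    by rewrite -SE /kummer_sum /series /= big_nat_recr//= addrK.
  rewrite e1 /GRing.scale /= -[in - (2 * b)]s22; ring.
have dD N (b : R) : 0 < b -> is_derive b 1 (D N)
    (- (Num.sqrt 2 * E b * kummer_term 2 ((Num.sqrt 2 * b) ^+ 2) N)).
  move=> b0; have := is_deriveB (dES N b) (is_deriveZ (Num.sqrt 2) (is_derive_gauss_int b0)).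
  by move=> /is_derive_eq; apply; rewrite /GRing.scale /= -/(E b); ring.
have D0 N : D N 0 = 0.
  rewrite /D gauss_int0 !mulr0 subr0 /S big1 ?mulr0// => i _.
  by rewrite expr0n mulr0.
have cD N : {within `[0, B], continuous (D N)}.
  apply: within_continuousB.
    apply: continuous_subspaceT => y; exact: is_derive_continuous (dES N y).
  move=> x; apply: cvgM; first exact: cvg_cst.
  exact: gauss_int_within (ltW B0) x.
have bD N : `|D N B| <= Num.sqrt 2 * B * kummer_term 2 (A ^+ 2) N.
  have dDI x : x \in `]0, B[ -> is_derive x 1 (D N)
      (- (Num.sqrt 2 * E x * kummer_term 2 ((Num.sqrt 2 * x) ^+ 2) N)).
    by rewrite in_itv/= => /andP[x0 _]; exact: dD.
  have [c] := MVT B0 dDI (cD N).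
  rewrite in_itv/= D0 !subr0 => /andP[c0 cB] ->.
  rewrite normrM (gtr0_norm B0) normrN normrM normrM (gtr0_norm s20).
  rewrite (ger0_norm (expR_ge0 _)) (ger0_norm (kummer_term_ge0 _ _ (sqr_ge0 _))).
  rewrite [leRHS]mulrAC ler_wpM2r ?(ltW B0)// -mulrA ler_wpM2l ?(ltW s20)//.
  rewrite -[leRHS]mul1r ler_pM ?expR_ge0 ?kummer_term_ge0 ?sqr_ge0//.
    by rewrite -expR0 ler_expR oppr_le0 sqr_ge0.
  rewrite /kummer_term ler_wpM2l ?kummer_coef_ge0// lerXn2r ?nnegrE ?sqr_ge0// AB.
  apply: lerXn2r; rewrite ?nnegrE.
  - by rewrite mulr_ge0 ?(ltW s20) ?(ltW c0).
  - by rewrite mulr_ge0 ?(ltW s20) ?(ltW B0).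
  - by apply: ler_wpM2l; rewrite ltW.
have c2 := @kummer_sum_is_cvg 2 _ isT (sqr_ge0 A).
have lim0 : D N B @[N --> \oo] --> (0 : R).
  apply/cvgr0Pnorm_le => e e0.
  have h0 : Num.sqrt 2 * B * kummer_term 2 (A ^+ 2) N @[N --> \oo] --> (0 : R).
    rewrite -[X in _ --> X](mulr0 (Num.sqrt 2 * B)); apply: cvgMl_tmp.
    exact: cvg_series_cvg_0 c2.
  near=> N; apply: (le_trans (bD N)); apply: (le_trans (ler_norm _)).
  by near: N; move/cvgr0Pnorm_le : h0; apply.
have lim1 : 1 + A * (E B)^-1 * (D N B + Num.sqrt 2 * gauss_int B) @[N --> \oo] -->
    1 + A * (E B)^-1 * (0 + Num.sqrt 2 * gauss_int B).
  by apply: cvgD; [exact: cvg_cst|apply: cvgMl_tmp; apply: cvgD lim0 _; exact: cvg_cst].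
have EB : (E B)^-1 = expR (A ^+ 2 / 2).
  by rewrite /E -expRN opprK /B expr_div_n s22.
move: lim1; rewrite EB add0r => lim1.
apply: cvg_lim => //; rewrite -cvg_shiftS; move: lim1.
apply: cvg_trans; apply: near_eq_cvg; apply: nearW => N /=.
by rewrite SE /D subrK -EB -AB mulrA divfK// gt_eqF// expR_gt0.
Unshelve. all: end_near. Qed.

(** The normalization by the expected growth [z^((k-1)/2) exp(z/2)]. *)
Definition kummer_ratio k z : R := kummer k z / (z `^ ((k%:R - 1) / 2) * expR (z / 2)).

Definition expansion_const k : R :=
  k%:R * Num.sqrt pi / (2 `^ ((k%:R - 1) / 2) * Gamma (k%:R / 2 + 1)).

Lemma powR_half_succ k z : 0 < z ->
  z `^ ((k.+2%:R - 1) / 2) = z `^ ((k%:R - 1) / 2) * z :> R.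
Proof.
move=> z0; rewrite (_ : (k.+2%:R - 1) / 2 = (k%:R - 1) / 2 + 1).
  by rewrite powRD ?(gt_eqF z0) ?implybT// powRr1// ltW.
by rewrite -addn2 natrD; field.
Qed.

Lemma kummer_ratio_shift k z : (0 < k)%N -> 0 < z ->
  kummer_ratio k z / k%:R <= kummer_ratio k.+2 z <=
  (((k.*2.-1)%:R / z + 1) / k%:R) * kummer_ratio k z.
Proof.
move=> k0 z0; have /andP[h1 h2] := kummer_shift k0 (ltW z0).
rewrite /kummer_ratio powR_half_succ//.
have k0' : 0 < k%:R :> R by rewrite ltr0n.
set P := z `^ _; set E := expR _.
have P0 : 0 < P by exact: powR_gt0.
have E0 : 0 < E by exact: expR_gt0.
have D0 : 0 < P * z * E by rewrite !mulr_gt0.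
rewrite ler_pdivlMr// ler_pdivrMr//; apply/andP; split.
  rewrite (_ : _ * (P * z * E) = (z * kummer k z) / k%:R); last first.
    by field; rewrite !gt_eqF.
  by rewrite ler_pdivrMr// [leRHS]mulrC.
rewrite (_ : _ * (P * z * E) = (((k.*2).-1%:R + z) * kummer k z) / k%:R); last first.
  by field; rewrite !gt_eqF.
by rewrite ler_pdivlMr// [leLHS]mulrC.
Qed.

(** Gamma is positive at every [k / 2 + 1], by two-step induction on [k]. *)
Lemma gamma_half k : exists2 l : R, 0 < l & gamma_primitive (k%:R / 2) l.
Proof.
elim/ltn_ind: k => -[|[|k]] IH.
- by exists 1 => //; rewrite mul0r; exact: gamma_primitive0.
- exists (Num.sqrt pi / 2); first by rewrite divr_gt0 ?sqrtr_gt0 ?pi_gt0.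
  by rewrite mul1r; exact: gamma_primitive_half.
- have [|l l0 hl] := IH k; first by rewrite ltnS leqW.
  exists ((k%:R / 2 + 1) * l); first by rewrite mulr_gt0// ltr_wpDl.
  rewrite (_ : k.+2%:R / 2 = k%:R / 2 + 1); last by rewrite -addn2 natrD; field.
  exact: gamma_primitive_succ.
Qed.

Lemma expansion_const_succ k : (0 < k)%N -> expansion_const k.+2 = expansion_const k / k%:R.
Proof.
move=> k0; have [l l0 hl] := gamma_half k.
have k0' : 0 < k%:R :> R by rewrite ltr0n.
rewrite /expansion_const powR_half_succ// (GammaE _ hl) ?divr_gt0//.
rewrite (_ : k.+2%:R / 2 = k%:R / 2 + 1); last by rewrite -addn2 natrD; field.
rewrite (GammaE _ (gamma_primitive_succ _ hl)) ?divr_ge0 ?addr_gt0 ?divr_gt0//.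
rewrite -addn2 natrD; set P := _ `^ _.
have P0 : 0 < P by exact: powR_gt0.
by field; rewrite !gt_eqF ?ltr_wpDl.
Qed.

Lemma expansion_const_gt0 k : (0 < k)%N -> 0 < expansion_const k.
Proof.
move=> k0; have [l l0 hl] := gamma_half k.
have p0 : 0 < k%:R / 2 :> R by rewrite divr_gt0 ?ltr0n.
rewrite /expansion_const (GammaE p0 hl).
by rewrite divr_gt0 ?mulr_gt0 ?sqrtr_gt0 ?pi_gt0 ?ltr0n ?powR_gt0.
Qed.

Lemma kummer_ratio_cvg1 : 2 * kummer_ratio 1 z @[z --> +oo] --> expansion_const 1.
Proof.
have -> : expansion_const 1 = 2 * 1.
  rewrite /expansion_const subrr !mul0r powRr0 !mul1r.
  have := @gamma_primitive_half R => /(GammaE _) -> //.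
  by rewrite invf_div mulrCA divff ?mulr1// gt_eqF// sqrtr_gt0 pi_gt0.
apply: cvgMl_tmp.
have h : (fun=> 1 : R) z @[z --> (+oo : set_system R)] --> (1 : R) by exact: cvg_cst.
apply: cvg_trans h; apply: near_eq_cvg.
near=> z; rewrite /kummer_ratio subrr mul0r powRr0 mul1r.
have -> : kummer 1 z = expR (z / 2) by apply: cvg_lim => //; exact: kummer_sum1_cvg.
by rewrite divff// gt_eqF// expR_gt0.
Unshelve. all: end_near. Qed.

Lemma kummer_ratio_cvg2 : 2 * kummer_ratio 2 z @[z --> +oo] --> expansion_const 2.
Proof.
have s20 : 0 < Num.sqrt 2 :> R by rewrite sqrtr_gt0.
have -> : expansion_const 2 = 2 * (0 + Num.sqrt 2 * (Num.sqrt pi / 2)).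
  rewrite /expansion_const divff// (_ : (2 - 1) / 2 = 2^-1 :> R); last by field.
  have := @gamma_primitive_succ R 0 1 (lexx _) (@gamma_primitive0 R).
  rewrite add0r mulr1 => /(GammaE _) -> //.
  rewrite powR12_sqrt// mulr1 add0r.
  have s22 : Num.sqrt 2 * Num.sqrt 2 = 2 :> R by rewrite -expr2 sqr_sqrtr.
  have e (s p : R) : s != 0 -> s * s = 2 -> 2 * p / s = 2 * (s * (p / 2)).
    by move=> s0 <-; field.
  by rewrite e ?gt_eqF.
apply: cvgMl_tmp.
have h1 : Num.sqrt 2 * gauss_int (Num.sqrt z / Num.sqrt 2)
    @[z --> +oo] --> Num.sqrt 2 * (Num.sqrt pi / 2 : R).
  apply: cvgMl_tmp; apply: cvg_comp (@gauss_int_cvgy R).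
  by apply: gt0_cvgMly (@cvg_sqrty R); rewrite invr_gt0.
have h2 : (Num.sqrt z)^-1 * expR (- (z / 2)) @[z --> +oo] --> (0 : R).
  apply: (@squeeze_cvgr _ _ _ _ (fun=> 0) (fun z => (Num.sqrt z)^-1)).
  - near=> z; have z0 : 0 <= z by near: z; apply: nbhs_pinfty_ge; rewrite num_real.
    rewrite mulr_ge0 ?invr_ge0 ?sqrtr_ge0 ?expR_ge0//=.
    by rewrite ler_piMr ?invr_ge0 ?sqrtr_ge0// -expR0 ler_expR oppr_le0 divr_ge0.
  - exact: cvg_cst.
  - apply/gtr0_cvgV0; last exact: cvg_sqrty.
    by near=> z; rewrite sqrtr_gt0; near: z; apply: nbhs_pinfty_gt; rewrite num_real.
apply: cvg_trans (cvgD h2 h1); apply: near_eq_cvg; near=> z.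
rewrite [LHS]/GRing.add /=.
have z0 : 0 < z by near: z; apply: nbhs_pinfty_gt; rewrite num_real.
have A0 : 0 < Num.sqrt z by rewrite sqrtr_gt0.
have zE : z = Num.sqrt z ^+ 2 by rewrite sqr_sqrtr// ltW.
rewrite /kummer_ratio [in kummer 2 z]zE kummer2// -zE (_ : (2 - 1) / 2 = 2^-1 :> R); last by field.
rewrite powR12_sqrt ?ltW// expRN.
have E0 : 0 < expR (z / 2) by exact: expR_gt0.
by field; rewrite !gt_eqF.
Unshelve. all: end_near. Qed.

(** [kummer_ratio_shift] squeezes the ratio for [k + 2] between multiples of the ratio for
    [k], both tending to [1 / k] times its limit, which is the recursion satisfied by
    [expansion_const]. *)
Lemma kummer_ratio_cvg k : (0 < k)%N -> 2 * kummer_ratio k z @[z --> +oo] --> expansion_const k.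
Proof.
elim/ltn_ind: k => -[|[|[|k]]]// IH _; first exact: kummer_ratio_cvg1.
  exact: kummer_ratio_cvg2.
have {}IH : 2 * kummer_ratio k.+1 z @[z --> +oo] --> expansion_const k.+1 by exact: IH.
have k0 : 0 < k.+1%:R :> R by rewrite ltr0n.
apply: (@squeeze_cvgr _ _ _ _ (fun z => k.+1%:R^-1 * (2 * kummer_ratio k.+1 z))
  (fun z => ((k.+1.*2.-1)%:R * z^-1 + 1) / k.+1%:R * (2 * kummer_ratio k.+1 z))).
- near=> z; have z0 : 0 < z by near: z; apply: nbhs_pinfty_gt; rewrite num_real.
  have /andP[h1 h2] := kummer_ratio_shift (ltn0Sn k) z0.
  apply/andP; split; [rewrite [leLHS]mulrCA|rewrite [leRHS]mulrCA]; rewrite ler_pM2l//.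
  by rewrite [leLHS]mulrC.
- by rewrite expansion_const_succ// mulrC; exact: cvgMl_tmp.
- have e : (k.+1.*2.-1%:R * 0 + 1) / k.+1%:R * expansion_const k.+1 = expansion_const k.+3.
    by rewrite expansion_const_succ// mulr0 add0r mul1r mulrC.
  rewrite -e; apply: cvgM IH; apply: cvgMr_tmp; apply: cvgD; last exact: cvg_cst.
  apply: cvgMl_tmp; apply/gtr0_cvgV0; last exact: cvg_id.
  by near=> z.
Unshelve. all: end_near. Qed.

End KummerSeries.

(** * The heat operator at a point and the maximum principle *)

Lemma cvg_ext (T : Type) (U : nbhsType) (F : set_system T) (f g : T -> U) (l : U) :
  f =1 g -> f @ F --> l -> g @ F --> l.
Proof. by move=> /funext ->. Qed.

Section MaxPrinciple.
Context {R : realType} {d : nat}.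
Implicit Types (x : 'rV[R]_d) (v u : R -> 'rV[R]_d -> R).

Lemma coord_le_norm x i : `|x ord0 i| <= `|x|.
Proof.
rewrite [leRHS]/Num.Def.normr /= mx_normrE; apply/bigmax_geP; right => /=.
by exists (ord0, i).
Qed.

Lemma norm_attained x : (0 < d)%N -> exists i, `|x| = `|x ord0 i|.
Proof.
move=> d0; have [x0|x0] := eqVneq `|x| 0.
  exists (Ordinal d0); apply/eqP; rewrite eq_le coord_le_norm andbT x0.
  exact: normr_ge0.
have [[i j] /= h] := mx_norm_neq0 x0.
by exists j; rewrite [LHS]h (ord1 i).
Qed.

Lemma is_derive_cvg (f : R -> R) (y l : R) : is_derive y 1 f l ->
  h^-1 * (f (h + y) - f y) @[h --> 0^'] --> l.
Proof.
move=> [df <-]; have h : (fun h => h^-1 *: (f (h *: 1 + y) - f y)) @ 0^' --> 'D_1 f y.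
  exact: df.
apply: cvg_ext h => h.
by rewrite /GRing.scale /= mulr1.
Qed.

Lemma second_derivative_at_max (g g1 : R -> R) (l : R) :
  (forall y : R, is_derive y 1 g (g1 y)) -> is_derive (0 : R) 1 g1 l ->
  (forall y, g y <= g 0) -> l <= 0.
Proof.
move=> dg dg1 gmax; rewrite leNgt; apply/negP => l0.
have g10 : g1 0 = 0.
  have zin : (0 : R) \in `]-1, 1[ by rewrite in_itv/= ltrN10 ltr01.
  have h := @derive1_at_max R g (-1) 1 0 _ _ zin (fun y _ => gmax y).
  have [|t _|_ e1] := h; [by lra|by have [] := dg t|].
  by have [_ e2] := dg 0; rewrite -e2 e1.
have := is_derive_cvg dg1 => /cvgr_gt /(_ 0 l0).
move=> /nbhs_ballP[e /= e0 he].
have e20 : 0 < e / 2 by rewrite divr_gt0.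
have cg : {within `[0, e / 2], continuous g}.
  by apply: continuous_subspaceT => y; exact: is_derive_continuous (dg y).
have [c] := MVT e20 (fun y _ => dg y) cg.
rewrite in_itv/= => /andP[c0 ce] h.
have := he c; rewrite /ball /= sub0r normrN gtr0_norm// addr0 g10 subr0.
move=> /(_ ltac:(lra) (lt0r_neq0 c0)); rewrite pmulr_rgt0 ?invr_gt0// => g1c.
have := gmax (e / 2); rewrite -subr_le0 h; apply/negP; rewrite -ltNge.
by rewrite subr0 mulr_gt0.
Qed.

(** The value [a] of [v_t + (eps / 2) Lap v] at [(s, x)].  Only the right time
    derivative enters: it exists at [s = 0], and it is the one that has a sign at a
    maximum over times in [s, T].  Space derivatives are taken along coordinate lines,
    so that only calculus in one real variable is used. *)
Definition heat_at (eps : R) v (s : R) x (a : R) : Prop :=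
  exists (b : R) (D1 : 'I_d -> R -> R) (l : 'I_d -> R),
  [/\ (r - s)^-1 * (v r x - v s x) @[r --> s^'+] --> b,
      forall i (y : R), is_derive y 1 (fun y => v s (x + y *: basis_vec R i)) (D1 i y),
      forall i, is_derive (0 : R) 1 (D1 i) (l i) &
      a = b + eps / 2 * \sum_i l i].

Lemma heat_at_lin eps v u s x a b c : heat_at eps v s x a -> heat_at eps u s x b ->
  heat_at eps (fun r y => v r y + c * u r y) s x (a + c * b).
Proof.
move=> [dv [D1v [lv [h1 h2 h3 ->]]]] [du [D1u [lu [k1 k2 k3 ->]]]].
exists (dv + c * du), (fun i y => D1v i y + c * D1u i y), (fun i => lv i + c * lu i).
split.
- have kc : c * ((r - s)^-1 * (u r x - u s x)) @[r --> s^'+] --> c * du.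
    exact: cvgMl_tmp.
  apply: cvg_ext (cvgD h1 kc) => r; rewrite [LHS]/GRing.add /=; ring.
- by move=> i y; exact: is_deriveD (h2 i y) (is_deriveZ c (k2 i y)).
- by move=> i; exact: is_deriveD (h3 i) (is_deriveZ c (k3 i)).
- by rewrite big_split -mulr_sumr /=; ring.
Qed.

Lemma heat_at_cst eps s x (c : R) : heat_at eps (fun _ _ => c) s x 0.
Proof.
exists 0, (fun _ _ => 0), (fun _ => 0); split.
- apply: cvg_ext (cvg_cst (0 : R)) => r.
  by rewrite subrr mulr0.
- by move=> i y; exact: is_derive_cst.
- by move=> i; exact: is_derive_cst.
- by rewrite big1// mulr0 addr0.
Qed.

Lemma heat_at_max eps v s x a : 0 < eps -> heat_at eps v s x a ->
  (\forall r \near s^'+, v r x <= v s x) -> (forall y, v s y <= v s x) -> a <= 0.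
Proof.
move=> e0 [b [D1 [l [h1 h2 h3 ->]]]] ht hx.
have b0 : b <= 0.
  apply: (ler_cvg_to h1 (cvg_cst (0 : R))); near=> r.
  have sr : s < r by near: r; exact: nbhs_right_gt.
  rewrite pmulr_rle0 ?invr_gt0 ?subr_gt0// subr_le0.
  by near: r.
have l0 i : l i <= 0.
  apply: (second_derivative_at_max (h2 i) (h3 i)) => y.
  by rewrite scale0r addr0.
have sl : \sum_i l i <= 0 by apply: sumr_le0.
have e2 : 0 < eps / 2 by rewrite divr_gt0.
by rewrite -oppr_ge0 opprD addr_ge0 ?oppr_ge0// pmulr_rle0.
Unshelve. all: end_near. Qed.

(** Outside a ball and at the final time [v] is nonpositive, so a positive maximum over
    the compact cylinder is a maximum over all of [0, T] x R^d, reached before [T]. *)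
Lemma exists_pos_max (T rho : R) v : 0 < T ->
  {within ccyl d T, continuous (uncur v)} ->
  (forall x, v T x <= 0) ->
  (forall s x, 0 <= s <= T -> rho <= `|x| -> v s x <= 0) ->
  forall t0 x0, 0 <= t0 <= T -> 0 < v t0 x0 ->
  exists s x, [/\ 0 <= s < T, 0 < v s x &
    forall r y, 0 <= r <= T -> v r y <= v s x].
Proof.
move=> T0 cv vT vrho t0 x0 ht0 v0.
pose K := [set p : R * 'rV[R]_d | 0 <= p.1 <= T /\ `|p.2| <= rho].
have KE : K = `[0, T]%classic `*` [set x : 'rV[R]_d | `|x| <= rho].
  by apply/seteqP; split => -[a b]/=; rewrite /K /= in_itv.
have x0r : `|x0| <= rho.
  by rewrite leNgt; apply/negP => /ltW /(vrho _ _ ht0); rewrite leNgt v0.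
have cK : compact K.
  rewrite KE; apply: compact_setX; first exact: segment_compact.
  apply: bounded_closed_compact.
    by exists rho; split; [rewrite num_real|move=> M rM x /= /le_trans; apply; exact: ltW].
  rewrite (_ : [set _ | _] = Num.norm @^-1` [set y | y <= rho]).
    by apply: closed_comp; [move=> x _; exact: norm_continuous|exact: closed_le].
  by [].
have KC : K `<=` ccyl d T by move=> -[a b] [/= h _]; split; rewrite //= in_itv.
have K0 : K !=set0 by exists (t0, x0).
have [[s x]] := compact_EVT_max K0 cK (continuous_subspaceW KC cv).
rewrite inE => -[/= hs hx] hmax.
have pos : 0 < v s x.
  by apply: lt_le_trans v0 _; apply: (hmax (t0, x0)); rewrite inE.
exists s, x; split => //.
  case/andP: hs => -> /=; rewrite le_eqVlt => /orP[/eqP sT|//].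
  by move: pos; rewrite sT ltNge vT.
move=> r y hr; have [yr|/ltW yr] := leP `|y| rho; last exact: le_trans (vrho _ _ hr yr) (ltW pos).
by apply: (hmax (r, y)); rewrite inE.
Qed.

End MaxPrinciple.

(** * Comparison for heat solutions of exponential growth *)

Section HeatComparison.
Context {R : realType} {d : nat}.
Implicit Types (x : 'rV[R]_d) (v u : R -> 'rV[R]_d -> R).

Lemma is_derive_right_cvg (f : R -> R) (s l : R) : is_derive s 1 f l ->
  (r - s)^-1 * (f r - f s) @[r --> s^'+] --> l.
Proof.
move=> /is_derive_cvg h.
have sh : (r - s) @[r --> s^'+] --> 0^'.
  move=> A /nbhs_ballP[e /= e0 eA]; change (\forall r \near s^'+, A (r - s)).
  near=> r; have sr : s < r by near: r; exact: nbhs_right_gt.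
  apply: eA; last by rewrite subr_eq0 gt_eqF.
  rewrite /ball /= sub0r normrN gtr0_norm ?subr_gt0// ltrBlDr.
  by near: r; apply: nbhs_right_lt; rewrite ltrDr.
apply: cvg_ext (cvg_comp _ _ sh h) => r /=.
by rewrite subrK.
Unshelve. all: end_near. Qed.

Lemma heat_atI (eps : R) v (s : R) x (b : R) (D1 : 'I_d -> R -> R) (l : 'I_d -> R) :
  is_derive s 1 (fun r : R => v r x) b ->
  (forall i (y : R), is_derive y 1 (fun y => v s (x + y *: basis_vec R i)) (D1 i y)) ->
  (forall i, is_derive (0 : R) 1 (D1 i) (l i)) ->
  heat_at eps v s x (b + eps / 2 * \sum_i l i).
Proof.
by move=> h1 h2 h3; exists b, D1, l; split => //; exact: is_derive_right_cvg.
Qed.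

Lemma line_coord x i j (y : R) :
  (x + y *: basis_vec R i) ord0 j = x ord0 j + y * (i == j)%:R.
Proof. by rewrite !mxE eqxx /= eq_sym. Qed.

Lemma is_derive_affine (a b y : R) : is_derive y 1 (fun y => a + y * b) b.
Proof.
have h : is_derive y 1 (fun y => y * b) b.
  have := is_deriveZ b (is_derive_id y (1 : R)).
  rewrite (_ : b \*: id = fun y => y * b); last first.
    by apply/funext => z; rewrite /GRing.scale /= mulrC.
  by move=> /is_derive_eq; apply; rewrite /GRing.scale /= mulr1.
have := is_deriveD (is_derive_cst a y 1) h => /is_derive_eq; apply.
by rewrite add0r.
Qed.

Lemma is_derive_expR_affine (a b y : R) :
  is_derive y 1 (fun y => expR (a + y * b)) (b * expR (a + y * b)).
Proof.
have := is_derive1_comp (is_derive_expR _) (is_derive_affine a b y).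
by rewrite mulrC.
Qed.

(** Exponentials of a single coordinate are eigenfunctions of the Laplacian; the
    rate [lam] in time adjusts the value of the heat operator. *)
Lemma heat_exp eps T lam m j s x :
  let f := fun r y => expR (lam * (T - r) + m * y ord0 j) in
  heat_at eps f s x ((eps * m ^+ 2 / 2 - lam) * f s x).
Proof.
move=> f.
pose mi i := m * (i == j)%:R.
have fl i (y : R) : f s (x + y *: basis_vec R i) =
    expR (lam * (T - s) + m * x ord0 j + y * mi i).
  by rewrite /f line_coord /mi; congr expR; ring.
have -> : (eps * m ^+ 2 / 2 - lam) * f s x =
    - lam * f s x + eps / 2 * \sum_i (mi i ^+ 2 * f s x).
  rewrite -mulr_suml (bigD1 j)//= /mi eqxx mulr1 big1 ?addr0; first by field.
  by move=> i /negbTE ->; rewrite mulr0 expr0n.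
apply: (@heat_atI _ _ _ _ _ (fun i y => mi i *
  expR (lam * (T - s) + m * x ord0 j + y * mi i))).
- have := is_derive_expR_affine (lam * T + m * x ord0 j) (- lam) s.
  rewrite (_ : (fun y => _) = f ^~ x); last first.
    by apply/funext => r; rewrite /f; congr expR; ring.
  by move/is_derive_eq; apply; rewrite /f; congr (_ * expR _); ring.
- move=> i y; rewrite (funext (fl i)); exact: is_derive_expR_affine.
- move=> i; have := is_deriveZ (mi i)
    (is_derive_expR_affine (lam * (T - s) + m * x ord0 j) (mi i) 0).
  move/is_derive_eq; apply.
  by rewrite mul0r addr0 /GRing.scale /= /f; ring.
Qed.

Lemma heat_at_sum eps (I : Type) (r : seq I) (F : I -> R -> 'rV[R]_d -> R) s x (a : I -> R) :
  (forall i, heat_at eps (F i) s x (a i)) ->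
  heat_at eps (fun r' y => \sum_(i <- r) F i r' y) s x (\sum_(i <- r) a i).
Proof.
move=> h; elim: r => [|i r IH].
  have -> : (fun (r' : R) (y : 'rV[R]_d) => \sum_(i <- [::]) F i r' y) = (fun _ _ => 0).
    by apply/funext => r'; apply/funext => y; rewrite big_nil.
  rewrite big_nil; exact: heat_at_cst.
have -> : (fun r' y => \sum_(i <- i :: r) F i r' y) =
    (fun r' y => F i r' y + 1 * \sum_(i <- r) F i r' y).
  by apply/funext => r'; apply/funext => y; rewrite big_cons mul1r.
by rewrite big_cons -[X in _ + X]mul1r; exact: heat_at_lin.
Qed.

Lemma continuous_coord_snd j : continuous (fun p : R * 'rV[R]_d => p.2 ord0 j).
Proof.
move=> p; apply: (cvg_comp snd (fun x : 'rV[R]_d => x ord0 j)); first exact: cvg_snd.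
exact: coord_continuous.
Qed.

(** A sum of exponentials rather than a Gaussian: it exists for all times, it dominates
    [exp(c |x|)] as soon as [c < M], and the extra [1] in the time rate makes it a strict
    supersolution. *)
Definition barrier (T eps M : R) (s : R) x : R :=
  \sum_(i < d) (expR ((eps * M ^+ 2 / 2 + 1) * (T - s) + M * x ord0 i)
    + 1 * expR ((eps * M ^+ 2 / 2 + 1) * (T - s) + (- M) * x ord0 i)).

Lemma barrier_heat T eps M s x :
  heat_at eps (barrier T eps M) s x (- barrier T eps M s x).
Proof.
rewrite {2}/barrier -sumrN; apply: heat_at_sum => i.
have h1 := heat_exp eps T (eps * M ^+ 2 / 2 + 1) M i s x.
have h2 := heat_exp eps T (eps * M ^+ 2 / 2 + 1) (- M) i s x.
have := heat_at_lin 1 h1 h2; congr heat_at; rewrite sqrrN; ring.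
Qed.

Lemma continuous_sumr (T : topologicalType) (I : Type) (r : seq I) (F : I -> T -> R) :
  (forall i, continuous (F i)) -> continuous (fun p => \sum_(i <- r) F i p).
Proof. by move=> h; apply: continuous_big => //; exact: add_continuous. Qed.

Lemma continuous_exp (T lam m : R) j :
  continuous (uncur (fun r (y : 'rV[R]_d) => expR (lam * (T - r) + m * y ord0 j))).
Proof.
move=> p; apply: continuous_cvg; first exact: continuous_expR.
apply: cvgD; apply: cvgMl_tmp; last exact: continuous_coord_snd.
by apply: cvgB; [exact: cvg_cst|exact: cvg_fst].
Qed.

Lemma barrier_continuous T eps M : continuous (uncur (barrier T eps M)).
Proof.
apply: continuous_sumr => i p.
apply: cvgD; [|apply: cvgMl_tmp]; exact: continuous_exp.
Qed.

Lemma barrier_ge T eps M s x : (0 < d)%N -> 0 <= eps -> 0 <= M -> s <= T ->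
  expR (M * `|x|) <= barrier T eps M s x.
Proof.
move=> d0 e0 M0 sT; have [i ->] := norm_attained x d0.
have pos j : 0 <= expR ((eps * M ^+ 2 / 2 + 1) * (T - s) + M * x ord0 j)
    + 1 * expR ((eps * M ^+ 2 / 2 + 1) * (T - s) + (- M) * x ord0 j).
  by rewrite mul1r addr_ge0 ?expR_ge0.
rewrite /barrier (bigD1 i)//= -[leLHS]addr0 lerD//; last exact: sumr_ge0.
have l0 : 0 <= (eps * M ^+ 2 / 2 + 1) * (T - s).
  by rewrite mulr_ge0 ?subr_ge0// addr_ge0// divr_ge0// mulr_ge0// sqr_ge0.
rewrite mul1r; have [x0|x0] := leP 0 (x ord0 i).
  by rewrite ler_wpDr ?expR_ge0// ler_expR ger0_norm// lerDr.
by rewrite ler_wpDl ?expR_ge0// ler_expR ltr0_norm// mulrN mulNr lerDr.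
Qed.

(** The constant [K] is independent of [e], and the radius [rho] depends on the
    growth of [v] but not on [v] itself.  This uniformity matters: the final value
    [exp(r / eps)] is approximated by polynomials only on balls, and the degree of the
    polynomial has to be chosen after [rho]. *)
Lemma heat_compare (eps T A c : R) : (0 < d)%N -> 0 < eps -> 0 < T -> 0 <= c ->
  exists K : R, forall e : R, 0 < e -> exists rho : R, forall v,
    {within ccyl d T, continuous (uncur v)} ->
    (forall s x, 0 <= s <= T -> v s x <= A * expR (c * `|x|)) ->
    (forall s x, 0 <= s < T -> heat_at eps v s x 0) ->
    (forall x, `|x| <= rho -> v T x <= e) ->
    forall s, 0 <= s <= T -> v s 0 <= e * K.
Proof.
move=> d0 eps0 T0 c0; pose M := c + 1; have M0 : 0 <= M by rewrite addr_ge0.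
pose B := barrier T eps M.
pose K : R := \sum_(i < d) 2 * expR ((eps * M ^+ 2 / 2 + 1) * T).
exists K => e e0; exists (A / e) => v cv vA vh vT s hs.
have B1 r y : r <= T -> 1 <= B r y.
  move=> rT; apply: le_trans (barrier_ge y d0 (ltW eps0) M0 rT).
  by rewrite -expR0 ler_expR mulr_ge0.
have far r y : 0 <= r <= T -> A / e <= `|y| -> v r y <= e * B r y.
  move=> /[dup] hr /andP[r0 rT] yA; apply: le_trans (vA _ _ hr) _.
  apply: (@le_trans _ _ (e * expR (M * `|y|))); last first.
    by rewrite ler_wpM2l ?(ltW e0)//; exact: barrier_ge (ltW eps0) M0 rT.
  rewrite /M mulrDl mul1r expRD mulrCA mulrC ler_wpM2l ?expR_ge0//.
  rewrite -ler_pdivrMl// mulrC; apply: (le_trans yA).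
  by apply: le_trans (expR_ge1Dx _); rewrite lerDr.
suff vB : v s 0 <= e * B s 0.
  apply: (le_trans vB); rewrite ler_wpM2l ?(ltW e0)// /B /barrier /K.
  apply: ler_sum => i _; rewrite mxE !mulr0 mul1r !addr0 mulr_natl mulr2n.
  have l0 : 0 <= eps * M ^+ 2 / 2 + 1.
    by rewrite addr_ge0// divr_ge0// mulr_ge0 ?sqr_ge0// ltW.
  have le : expR ((eps * M ^+ 2 / 2 + 1) * (T - s)) <= expR ((eps * M ^+ 2 / 2 + 1) * T).
    by rewrite ler_expR ler_wpM2l// gerBl; case/andP: hs.
  exact: lerD.
(* At a positive maximum of D the heat operator of D would be e * B > 0. *)
pose D r y := v r y + (- e) * B r y.
rewrite leNgt; apply/negP => vB.
have cD : {within ccyl d T, continuous (uncur D)}.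
  apply: within_continuousD => //.
  apply: continuous_subspaceT => p; apply: cvgMl_tmp; exact: barrier_continuous.
have DT y : D T y <= 0.
  rewrite /D mulNr subr_le0; have [yA|/ltW yA] := leP `|y| (A / e).
    by apply: (le_trans (vT _ yA)); rewrite ler_peMr ?B1 ?(ltW e0).
  by apply: far => //; rewrite lexx ltW.
have Dfar r y : 0 <= r <= T -> A / e <= `|y| -> D r y <= 0.
  by move=> hr yA; rewrite /D mulNr subr_le0 far.
have Ds : 0 < D s 0 by rewrite /D mulNr subr_gt0.
have [r [y [/andP[r0 rT] posD maxD]]] := exists_pos_max T0 cD DT Dfar hs Ds.
have hr : 0 <= r < T by rewrite r0.
have hD := heat_at_lin (- e) (vh r y hr) (barrier_heat T eps M r y).
have near_max : \forall r' \near r^'+, D r' y <= D r y.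
  near=> r'; apply: maxD; apply/andP; split.
    by apply: (le_trans r0); near: r'; exact: nbhs_right_ge.
  by near: r'; exact: nbhs_right_le.
have hr' : 0 <= r <= T by rewrite r0 ltW.
have := heat_at_max eps0 hD near_max (fun z => maxD r z hr').
rewrite add0r mulrNN.
apply/negP; rewrite -ltNge mulr_gt0//; exact: lt_le_trans (B1 r y (ltW rT)).
Unshelve. all: end_near. Qed.

End HeatComparison.

(** * Radial heat polynomials *)

Section HeatPolynomials.
Context {R : realType} {d : nat}.
Context (k : nat).
Implicit Types (x : 'rV[R]_d) (p q : {poly R}).

(** The squared Euclidean norm of the projection, the variable of all radial functions. *)
Definition sqnorm_first x : R := \sum_(i < d) (proj_first k x) ord0 i ^+ 2.

(** Half the Laplacian acting on functions of the squared norm [rho] in dimension [k]: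
    [Lap (q o rho) = 4 rho q'' + 2 k q']. *)
Definition radial_op q : {poly R} := 2 *: ('X * q^`(2)) + k%:R *: q^`().

Lemma sqnorm_first_line x i (y : R) :
  sqnorm_first (x + y *: basis_vec R i) =
  sqnorm_first x + (i < k)%:R * (2 * x ord0 i * y + y ^+ 2).
Proof.
rewrite /sqnorm_first (bigD1 i)//= [in RHS](bigD1 i)//= addrAC; congr (_ + _).
  rewrite /proj_first !mxE !eqxx /=.
  by case: (i < k)%N; rewrite ?mulr1n ?mulr0n; ring.
apply: eq_bigr => j ji; rewrite /proj_first mxE [in RHS]mxE; case: ifP => // _.
by rewrite line_coord eq_sym (negbTE ji) mulr0 addr0.
Qed.

Lemma sqnorm_firstE x : sqnorm_first x = \sum_(i < d) (i < k)%:R * x ord0 i ^+ 2.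
Proof.
by apply: eq_bigr => i _; rewrite mxE; case: ifP => _; rewrite ?mul1r// mul0r expr0n.
Qed.

Lemma sqnorm_first_ge0 x : 0 <= sqnorm_first x.
Proof. by apply: sumr_ge0 => i _; exact: sqr_ge0. Qed.

Lemma sqnorm_first_le x : sqnorm_first x <= d%:R * `|x| ^+ 2.
Proof.
have -> : d%:R * `|x| ^+ 2 = \sum_(i < d) `|x| ^+ 2.
  by rewrite sumr_const card_ord mulr_natl.
rewrite sqnorm_firstE; apply: ler_sum => i _.
rewrite -[leRHS]mul1r ler_pM ?sqr_ge0//; first by rewrite lern1 leq_b1.
by rewrite -(real_normK (num_real (x ord0 i))) lerXn2r ?nnegrE// coord_le_norm.
Qed.

Lemma sqrt_sqnorm_first_le x : Num.sqrt (sqnorm_first x) <= d%:R * `|x|.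
Proof.
rewrite -[leRHS]ger0_norm ?mulr_ge0// -sqrtr_sqr ler_wsqrtr//.
apply: (le_trans (sqnorm_first_le x)); rewrite exprMn ler_wpM2r ?sqr_ge0//.
by rewrite -natrX ler_nat -mulnn; case: (d) => // n; rewrite leq_pmulr.
Qed.

Lemma sqnorm_first0 : sqnorm_first 0 = 0.
Proof. by rewrite sqnorm_firstE big1// => i _; rewrite mxE expr0n mulr0. Qed.

Lemma continuous_sqnorm_first : continuous sqnorm_first.
Proof.
rewrite (funext sqnorm_firstE); apply: continuous_sumr => i x.
have h : {for x, continuous (fun y : 'rV[R]_d => y ord0 i ^+ 2)}.
  apply: (cvg_comp (fun y : 'rV[R]_d => y ord0 i) (fun z : R => z ^+ 2)).
    exact: coord_continuous.
  exact: exprn_continuous.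
exact: (cvgMl_tmp h).
Qed.

Lemma heat_radial eps (h : R -> R) (h' s : R) q x : (k <= d)%N ->
  is_derive s 1 h h' ->
  heat_at eps (fun r y => h r * q.[sqnorm_first y]) s x
    (h' * q.[sqnorm_first x] + eps * h s * (radial_op q).[sqnorm_first x]).
Proof.
move=> kd dh.
pose b (i : 'I_d) : R := (i < k)%:R.
pose c i (y : R) := sqnorm_first x + b i * (2 * x ord0 i * y + y ^+ 2).
have dc i (y : R) : is_derive y 1 (c i) (b i * (2 * x ord0 i + 2 * y)).
  have := is_deriveD (is_derive_affine (sqnorm_first x) (b i * (2 * x ord0 i)) y)
    (is_deriveZ (b i) (is_derive_expn 2 y)).
  rewrite (_ : _ + _ = c i); last first.
    by apply/funext => z; rewrite /c [LHS]/GRing.add /= /GRing.scale /=; ring.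
  by move/is_derive_eq; apply; rewrite /GRing.scale /= expr1; ring.
have dq q0 i (y : R) : is_derive y 1 (fun y => q0.[c i y])
    (q0^`().[c i y] * (b i * (2 * x ord0 i + 2 * y))).
  exact: is_derive1_comp (is_derive_poly q0 (c i y)) (dc i y).
have -> : h' * q.[sqnorm_first x] + eps * h s * (radial_op q).[sqnorm_first x] =
    h' * q.[sqnorm_first x] + eps / 2 * \sum_i h s *
      (q^`(2).[sqnorm_first x] * (b i * (2 * x ord0 i)) ^+ 2 + q^`().[sqnorm_first x] * (b i * 2)).
  congr (_ + _); rewrite -mulr_sumr big_split/= -!mulr_sumr.
  have -> : \sum_(i < d) b i * 2 = 2 * k%:R.
    rewrite -mulr_suml mulrC; congr (_ * _).
    rewrite /b -natr_sum; congr (_%:R); rewrite -big_mkcond /=.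
    by rewrite -(big_ord_widen d (fun=> 1%N)) // sum1_card card_ord.
  have -> : \sum_(i < d) (b i * (2 * x ord0 i)) ^+ 2 = 4 * sqnorm_first x.
    rewrite sqnorm_firstE mulr_sumr; apply: eq_bigr => i _; rewrite /b.
    by case: (i < k)%N; rewrite ?mulr1n ?mulr0n; ring.
  by rewrite /radial_op -[q^`(2)]/(q^`()^`()) !hornerE /=; field.
apply: (@heat_atI _ _ _ _ _ _ _ (fun i y => h s *
  (q^`().[c i y] * (b i * (2 * x ord0 i + 2 * y))))).
- have := is_deriveM dh (is_derive_cst q.[sqnorm_first x] s 1) => /is_derive_eq; apply.
  by rewrite /GRing.scale /= mulr0 add0r mulrC.
- move=> i y; rewrite (_ : (fun _ => _) = (fun y => h s * q.[c i y])).
    exact: is_deriveZ (dq q i y).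
  by apply/funext => z; rewrite sqnorm_first_line.
- move=> i.
  have h1 : is_derive (0 : R) 1 (fun y : R => b i * (2 * x ord0 i + 2 * y)) (b i * 2).
    have := is_derive_affine (b i * (2 * x ord0 i)) (b i * 2) 0.
    by congr is_derive; apply/funext => y; ring.
  have := is_deriveZ (h s) (is_deriveM (dq q^`() i 0) h1) => /is_derive_eq; apply.
  by rewrite /GRing.scale /= /c !mulr0 expr0n /= !addr0 !mulr0 !addr0; ring.
Qed.

(** The exponential series [exp(eps (T - s) L) p] truncated at order [n]. *)
Definition heat_poly (eps T : R) (n : nat) p (s : R) x : R :=
  \sum_(j < n) (eps * (T - s)) ^+ j / j`!%:R * (iter j radial_op p).[sqnorm_first x].

(** The time derivative of the term of order [j + 1] cancels the Laplacian of the term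
    of order [j], so only the last Laplacian survives. *)
Lemma heat_poly_partial eps T n p s x : (k <= d)%N ->
  heat_at eps (heat_poly eps T n.+1 p) s x
    (eps * ((eps * (T - s)) ^+ n / n`!%:R * (iter n.+1 radial_op p).[sqnorm_first x])).
Proof.
move=> kd.
pose h j (r : R) := (eps * (T - r)) ^+ j / j`!%:R.
have dpow j : is_derive s 1 (h j) (- eps * (j%:R * (eps * (T - s)) ^+ j.-1 / j`!%:R)).
  have h1 := is_derive_affine (eps * T) (- eps) s.
  have h2 := is_derive1_comp (is_derive_expn j _) h1.
  have := is_deriveZ (j`!%:R^-1) h2.
  rewrite (_ : _ \*: _ = h j); last first.
    apply/funext => r; rewrite /h /= [LHS]/GRing.scale /= mulrC.
    by congr (_ ^+ _ / _); ring.
  move/is_derive_eq; apply; rewrite /GRing.scale /= [in RHS]mulrC.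
  by rewrite (_ : eps * T + s * - eps = eps * (T - s)); ring.
elim: n => [|n IH].
  have := heat_radial eps p x kd (dpow 0%N).
  rewrite (_ : (fun _ _ => _) = heat_poly eps T 1 p); last first.
    by apply/funext => r; apply/funext => y; rewrite /heat_poly big_ord1.
  congr heat_at; rewrite /h /= mulr0n !mul0r mulr0 mul0r add0r.
  by rewrite -mulrA.
have := heat_at_lin 1 IH (heat_radial eps (iter n.+1 radial_op p) x kd (dpow n.+1)).
rewrite (_ : (fun _ _ => _) = heat_poly eps T n.+2 p); last first.
  by apply/funext => r; apply/funext => y; rewrite /heat_poly [in RHS]big_ord_recr mul1r.
congr heat_at; rewrite /h -iterS /= mul1r.
have -> : n.+1%:R * (eps * (T - s)) ^+ n / n.+1`!%:R = (eps * (T - s)) ^+ n / n`!%:R.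
  rewrite factS natrM invfM mulrCA !mulrA -mulrA mulrC -!mulrA mulVf ?mulr1//.
by ring.
Qed.

(** [L] maps [X^(m+1)] to [(m + 1) (k + 2 m) X^m]. *)
Lemma iter_radial_coef n p m :
  (iter n radial_op p)`_m =
  \prod_(i < n) ((m + i).+1 * (k + (m + i).*2))%:R * p`_(m + n).
Proof.
elim: n p m => [|n IH] p m; first by rewrite big_ord0 mul1r addn0.
rewrite iterSr IH big_ord_recr /= -mulrA; congr (_ * _).
rewrite /radial_op coefD !coefZ coefXM !coef_deriv addnS.
case: (m + n)%N => [|l] /=.
  by rewrite !mulr0 add0r mul1n addn0.
rewrite -[_ *+ l.+1]mulr_natr -[_ *+ l.+2]mulr_natr -muln2.
rewrite natrM natrD [(l.+1 * 2)%:R]natrM.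
move: l.+2%:R l.+1%:R (k%:R : R) (p`_l.+2) => a b e c; ring.
Qed.

Lemma heat_poly_heat eps T n p s x : (k <= d)%N -> (size p <= n.+1)%N ->
  heat_at eps (heat_poly eps T n.+1 p) s x 0.
Proof.
move=> kd pn; have := heat_poly_partial eps T n p s x kd; congr heat_at.
have -> : iter n.+1 radial_op p = 0.
  apply/polyP => m; rewrite coef0 iter_radial_coef nth_default ?mulr0//.
  by rewrite (leq_trans pn) ?leq_addl.
by rewrite horner0 !mulr0.
Qed.

Lemma heat_poly_continuous eps T n p : continuous (uncur (heat_poly eps T n p)).
Proof.
apply: continuous_sumr => j p0.
apply: (@cvgM _ _ (nbhs p0) _ (fun p : R * 'rV[R]_d => (eps * (T - p.1)) ^+ j / j`!%:R)).
  apply: cvgMr_tmp; apply: (cvg_comp (fun p : R * 'rV[R]_d => eps * (T - p.1)) (fun z : R => z ^+ j)).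
    by apply: cvgMl_tmp; apply: cvgB; [exact: cvg_cst|exact: cvg_fst].
  exact: exprn_continuous.
apply: (cvg_comp (fun p : R * 'rV[R]_d => sqnorm_first p.2) (fun z : R => (iter j radial_op p).[z])).
  by apply: (cvg_comp snd sqnorm_first); [exact: cvg_snd|exact: continuous_sqnorm_first].
exact: continuous_horner.
Qed.

Lemma heat_poly_end eps T n p x : heat_poly eps T n.+1 p T x = p.[sqnorm_first x].
Proof.
rewrite /heat_poly subrr mulr0 big_ord_recl big1 ?addr0.
  by rewrite expr0 fact0 divr1 mul1r.
by move=> i _; rewrite lift0 expr0n !mul0r.
Qed.

Lemma heat_poly_ge0 eps T n p s x : 0 <= eps -> s <= T -> (forall m, 0 <= p`_m) ->
  0 <= heat_poly eps T n p s x.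
Proof.
move=> e0 sT p0; apply: sumr_ge0 => j _; apply: mulr_ge0.
  by rewrite divr_ge0// exprn_ge0// mulr_ge0// subr_ge0.
rewrite horner_coef; apply: sumr_ge0 => m _; rewrite mulr_ge0 ?exprn_ge0 ?sqnorm_first_ge0//.
by rewrite iter_radial_coef mulr_ge0// prodr_ge0.
Qed.

Lemma exprn_le_fact_expR (y : R) n : 0 <= y -> y ^+ n <= n`!%:R * expR y.
Proof.
move=> y0; case: n => [|n].
  by rewrite expr0 fact0 mul1r -expR0 ler_expR.
rewrite mulrC -ler_pdivrMr ?ltr0n ?fact_gt0//.
by apply: le_trans (expR_ge1Dxn n y0); rewrite lerDr.
Qed.

(** [|x|^(2 i) <= (2 i)! exp |x|] bounds each monomial. *)
Lemma radial_growth q :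
  exists2 A : R, 0 <= A & forall x, q.[sqnorm_first x] <= A * expR `|x|.
Proof.
exists (\sum_(i < size q) `|q`_i| * (d%:R ^+ i * (i.*2)`!%:R)).
  by apply: sumr_ge0 => i _; rewrite !mulr_ge0 ?exprn_ge0.
move=> x; rewrite horner_coef mulr_suml; apply: ler_sum => i _.
apply: (le_trans (ler_norm _)); rewrite normrM -mulrA ler_wpM2l//.
rewrite ger0_norm ?exprn_ge0 ?sqnorm_first_ge0//.
apply: (@le_trans _ _ ((d%:R * `|x| ^+ 2) ^+ i)).
  by apply: lerXn2r; rewrite ?nnegrE ?sqnorm_first_ge0 ?mulr_ge0 ?exprn_ge0 ?sqnorm_first_le.
by rewrite exprMn -exprM mul2n -mulrA ler_wpM2l ?exprn_ge0// exprn_le_fact_expR.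
Qed.

Lemma heat_poly_growth eps T n p : 0 <= eps ->
  exists A, forall s x, 0 <= s <= T -> heat_poly eps T n p s x <= A * expR `|x|.
Proof.
move=> e0; elim: n => [|n [A hA]].
  by exists 0 => s x _; rewrite /heat_poly big_ord0 mul0r.
have [B B0 hB] := radial_growth (iter n radial_op p).
exists (A + (eps * T) ^+ n / n`!%:R * B) => s x hs.
rewrite /heat_poly big_ord_recr /= mulrDl lerD ?hA//.
case/andP: hs => s0 sT.
have h0 : 0 <= (eps * (T - s)) ^+ n / n`!%:R.
  by rewrite divr_ge0// exprn_ge0// mulr_ge0// subr_ge0.
apply: (@le_trans _ _ ((eps * (T - s)) ^+ n / n`!%:R * (B * expR `|x|))).
  by rewrite ler_wpM2l.
rewrite mulrA ler_wpM2r ?expR_ge0// ler_wpM2r// ler_wpM2r ?invr_ge0//.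
have T0 : 0 <= T by exact: le_trans s0 sT.
by apply: lerXn2r; rewrite ?nnegrE ?mulr_ge0 ?subr_ge0// ler_wpM2l// gerBl.
Qed.

Lemma heat_poly0 eps T n p s :
  heat_poly eps T n p s 0 =
  \sum_(j < n) (eps * (T - s)) ^+ j * \prod_(i < j) (k + i.*2)%:R * p`_j.
Proof.
apply: eq_bigr => j _; rewrite sqnorm_first0 horner_coef0 iter_radial_coef add0n.
rewrite !mulrA; congr (_ * _); rewrite -mulrA; congr (_ * _).
elim: (val j) => [|i IH]; first by rewrite !big_ord0 fact0 invr1 mul1r.
rewrite !big_ord_recr /= -IH factS !natrM invfM.
have i1 : i.+1%:R != 0 :> R by rewrite pnatr_eq0.
have i2 : i`!%:R != 0 :> R by rewrite pnatr_eq0 -lt0n fact_gt0.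
by field; rewrite nat1r i1 i2.
Qed.

(** The Taylor polynomial of [2 cosh(r / eps)] as a polynomial in [r^2]. *)
Definition cosh_poly (eps : R) n : {poly R} :=
  \poly_(m < n) (2 / ((m.*2)`!%:R * eps ^+ m.*2)).

Lemma kummer_coefE j : kummer_coef k j = \prod_(i < j) (k + i.*2)%:R / (j.*2)`!%:R :> R.
Proof.
elim: j => [|j IH]; first by rewrite kummer_coef0 big_ord0 fact0 divr1.
rewrite kummer_coefS IH big_ord_recr /= doubleS !factS !natrM.
have j1 : j.*2.+1%:R != 0 :> R by rewrite pnatr_eq0.
have j2 : j.*2.+2%:R != 0 :> R by rewrite pnatr_eq0.
have j3 : (j.*2)`!%:R != 0 :> R by rewrite pnatr_eq0 -lt0n fact_gt0.
move: j1 j2 j3; move: (j.*2.+1%:R : R) (j.*2.+2%:R : R) ((j.*2)`!%:R : R) => a b c j1 j2 j3.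
by field; rewrite j1 j2 j3.
Qed.

Definition cosh_sum n (y : R) : R := 2 * \sum_(m < n) y ^+ m.*2 / (m.*2)`!%:R.

Lemma cosh_polyE eps n r : (cosh_poly eps n).[r ^+ 2] = cosh_sum n (r / eps).
Proof.
rewrite horner_poly /cosh_sum mulr_sumr; apply: eq_bigr => m _.
by rewrite -exprM mul2n expr_div_n invfM; ring.
Qed.

Lemma cosh_sumE n (y : R) :
  cosh_sum n y = series (exp_coeff y) n.*2 + series (exp_coeff (- y)) n.*2.
Proof.
rewrite /cosh_sum /series /=; elim: n => [|n IH].
  by rewrite big_ord0 !big_geq// mulr0 addr0.
rewrite big_ord_recr /= mulrDr IH doubleS !big_nat_recr//= /exp_coeff /=.
by rewrite !exprS [(- y) ^+ n.*2]exprNn -signr_odd odd_double expr0; ring.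
Qed.

Lemma cvg_double : (n.*2 @[n --> \oo] --> \oo)%N.
Proof.
move=> A [N _ hN]; exists N => // n /= Nn; apply: hN => /=.
by rewrite (leq_trans Nn)// -addnn leq_addr.
Qed.

Lemma cosh_sum_cvg (y : R) : cosh_sum n y @[n --> \oo] --> expR y + expR (- y).
Proof.
rewrite (funext (fun n => cosh_sumE n y)); apply: cvgD.
  exact: cvg_comp cvg_double (@is_cvg_series_exp_coeff R y).
exact: cvg_comp cvg_double (@is_cvg_series_exp_coeff R (- y)).
Qed.

Lemma cosh_sum_ndecr (y : R) : {homo cosh_sum^~ y : m n / (m <= n)%N >-> m <= n}.
Proof.
apply/nondecreasing_seqP => n; rewrite /cosh_sum big_ord_recr /= ler_wpM2l// lerDl.
by rewrite divr_ge0// exprn_even_ge0// odd_double.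
Qed.

Lemma cosh_sum_le n (y : R) : cosh_sum n y <= expR y + expR (- y).
Proof.
rewrite -(cvg_lim (@Rhausdorff R) (@cosh_sum_cvg y)).
apply: nondecreasing_cvgn_le; first exact: cosh_sum_ndecr.
by apply/cvg_ex; exists (expR y + expR (- y)); exact: cosh_sum_cvg.
Qed.

(** The tails of a power series with nonnegative coefficients increase on the positive
    half-line; this turns pointwise into uniform convergence on bounded intervals. *)
Lemma cosh_sum_tail n (y z : R) : 0 <= y <= z ->
  (expR y + expR (- y)) - cosh_sum n y <= (expR z + expR (- z)) - cosh_sum n z.
Proof.
move=> /andP[y0 yz].
have h (w : R) : cosh_sum N w - cosh_sum n w @[N --> \oo] -->
    (expR w + expR (- w)) - cosh_sum n w.
  by apply: cvgB; [exact: cosh_sum_cvg|exact: cvg_cst].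
apply: (ler_cvg_to (h y) (h z)); near=> N.
have nN : (n <= N)%N by near: N; exact: nbhs_infty_ge.
rewrite /cosh_sum -!mulrBr ler_wpM2l// -(subnKC nN) !big_split_ord /=.
rewrite ![_ + _ - _]addrAC !subrr !add0r; apply: ler_sum => i _.
by rewrite ler_wpM2r ?invr_ge0// lerXn2r ?nnegrE// (le_trans y0).
Unshelve. all: end_near. Qed.

(** At the origin only the constant coefficients of the iterates of [L] remain, and
    they give the partial sums of the hypergeometric series. *)
Lemma heat_poly_cosh0 eps T n s : 0 < eps ->
  heat_poly eps T n (cosh_poly eps n) s 0 = 2 * kummer_sum k ((T - s) / eps) n.
Proof.
move=> e0; rewrite heat_poly0 /kummer_sum /series /= big_mkord mulr_sumr.
apply: eq_bigr => j _; rewrite coef_poly ltn_ord /kummer_term kummer_coefE.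
have e2 : eps ^+ j.*2 = eps ^+ j * eps ^+ j by rewrite -addnn exprD.
rewrite exprMn expr_div_n e2 !invfM.
have : eps ^+ j != 0 by rewrite expf_neq0// gt_eqF.
move: (_`!%:R^-1) (\prod_(i < j) _) (eps ^+ j) => a b c c0.
by field.
Qed.

Lemma cosh_poly_ge0 eps n m : 0 <= (cosh_poly eps n)`_m.
Proof.
rewrite coef_poly; case: ifP => // _.
by rewrite divr_ge0// mulr_ge0// exprn_even_ge0// odd_double.
Qed.

Lemma cosh_poly_le eps n (r : R) : 0 < eps -> 0 <= r ->
  (cosh_poly eps n).[r ^+ 2] <= expR (r / eps) + 1.
Proof.
move=> e0 r0; rewrite cosh_polyE; apply: (le_trans (cosh_sum_le _ _)).
by rewrite lerD2l -expR0 ler_expR oppr_le0 divr_ge0// ltW.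
Qed.

Lemma cosh_poly_approx eps (r0 e : R) : 0 < eps -> 0 < e ->
  exists n, forall r, 0 <= r <= r0 ->
  expR (r / eps) <= (cosh_poly eps n.+1).[r ^+ 2] + e.
Proof.
move=> eps0 e0; pose z := r0 / eps.
have /cvgrPdist_le /(_ _ e0) [N _ hN] := @cosh_sum_cvg z.
exists N => r /andP[r00 rr0]; rewrite cosh_polyE.
have yz : 0 <= r / eps <= z by rewrite divr_ge0 ?(ltW eps0)//= ler_pM2r ?invr_gt0.
have := hN N.+1 (leqnSn N); rewrite ger0_norm ?subr_ge0 ?cosh_sum_le// => h.
have := le_trans (cosh_sum_tail N.+1 yz) h.
have := expR_ge0 (- (r / eps)); lra.
Qed.

End HeatPolynomials.

(** * The Cole-Hopf transform *)

Section ColeHopf.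
Context {R : realType} {d : nat}.
Implicit Types (x : 'rV[R]_d) (u : R -> 'rV[R]_d -> R).

Lemma le_of_approx (a b K : R) : (forall e, 0 < e -> a <= b + e * K) -> a <= b.
Proof.
move=> h; apply/ler_addgt0Pr => e e0.
have K0 : 0 < `|K| + 1 by rewrite ltr_wpDl.
apply: (le_trans (h _ (divr_gt0 e0 K0))); rewrite lerD2l -mulrA ger_pMr//.
by rewrite ler_pdivrMl// mulr1; have := ler_norm K; lra.
Qed.

Lemma enorm_sqr x : enorm x ^+ 2 = \sum_(i < d) x ord0 i ^+ 2.
Proof. by rewrite /enorm sqr_sqrtr// sumr_ge0// => i _; exact: sqr_ge0. Qed.

Lemma enorm_projE k x : enorm (proj_first k x) = Num.sqrt (sqnorm_first k x).
Proof. by []. Qed.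

Lemma coord_le_enorm x i : `|x ord0 i| <= enorm x.
Proof.
rewrite -sqrtr_sqr ler_wsqrtr// (bigD1 i)//= lerDl sumr_ge0// => j _.
exact: sqr_ge0.
Qed.

Lemma is_derive_line (f : 'rV[R]_d -> R) x (v : 'rV[R]_d) (y : R) :
  derivable f (x + y *: v) v ->
  is_derive y 1 (fun y => f (x + y *: v)) ('D_v f (x + y *: v)).
Proof.
move=> df.
have e : (fun h : R => h^-1 *: (f (x + (h *: 1 + y) *: v) - f (x + y *: v))) =
    (fun h => h^-1 *: (f (h *: v + (x + y *: v)) - f (x + y *: v))).
  apply/funext => h; congr (_ *: (f _ - _)).
  by rewrite [h *: 1]mulr1 scalerDl addrCA.
apply: DeriveDef.
  by rewrite /derivable e.
by rewrite /derive e.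
Qed.

Lemma pderive_line i u s x (y : R) : pderivable i u s (x + y *: basis_vec R i) ->
  is_derive y 1 (fun y => u s (x + y *: basis_vec R i))
    (pderive i u s (x + y *: basis_vec R i)).
Proof. exact: is_derive_line. Qed.

Lemma proj_first0 x : proj_first 0 x = 0.
Proof. by apply/rowP => i; rewrite !mxE. Qed.

Lemma proj_first_full x : proj_first d x = x.
Proof. by apply/rowP => i; rewrite mxE ltn_ord. Qed.

Lemma proj_first_succ x (i : 'I_d) :
  proj_first i.+1 x = proj_first i x + x ord0 i *: basis_vec R i.
Proof.
apply/rowP => j; rewrite !mxE eqxx /= ltnS leq_eqVlt.
have [->|ji] := eqVneq j i; first by rewrite ltnn eqxx mulr1 add0r.
by rewrite (_ : (j == i :> nat) = false) ?mulr0 ?addr0//; apply/negbTE.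
Qed.

(** Moving from [0] to [x] along the coordinate axes, one coordinate at a time, needs
    only the mean value theorem along lines. *)
Lemma lipschitz_of_pderive (f : 'rV[R]_d -> R) (C : R) :
  (forall x i, derivable f x (basis_vec R i)) ->
  (forall x i, `|'D_(basis_vec R i) f x| <= C) ->
  forall x, `|f x - f 0| <= C * (d%:R * `|x|).
Proof.
move=> df dC x.
have step (i : 'I_d) z (a : R) : `|f (z + a *: basis_vec R i) - f z| <= C * `|a|.
  pose g y := f (z + y *: basis_vec R i).
  have dg (y : R) : is_derive y 1 g ('D_(basis_vec R i) f (z + y *: basis_vec R i)).
    exact: is_derive_line.
  have mvt (p q : R) : p < q -> `|g q - g p| <= C * `|q - p|.
    move=> pq; have cg : {within `[p, q], continuous g}.
      by apply: continuous_subspaceT => y; exact: is_derive_continuous (dg y).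
    have [c _ ->] := MVT pq (fun y _ => dg y) cg.
    by rewrite normrM ler_wpM2r.
  have -> : f z = g 0 by rewrite /g scale0r addr0.
  rewrite -/(g a); have [a0|a0|->] := ltgtP a 0.
  - by rewrite distrC -[a in leRHS]opprK normrN -[- a]add0r mvt.
  - by rewrite -[a in leRHS]subr0 mvt.
  - by rewrite subrr !normr0 mulr0.
have tel n : (n <= d)%N -> `|f (proj_first n x) - f 0| <= C * (n%:R * `|x|).
  elim: n => [|n IH] nd; first by rewrite proj_first0 subrr normr0 mul0r mulr0.
  rewrite (proj_first_succ x (Ordinal nd)) /= -natr1 mulrDl mul1r mulrDr.
  have e (a b c : R) : a - b = (c - b) + (a - c) by ring.
  rewrite (e _ _ (f (proj_first n x))).
  apply: (le_trans (ler_normD _ _)); rewrite lerD ?IH ?(ltnW nd)//.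
  apply: (le_trans (step _ _ _)).
  have C0 : 0 <= C by exact: le_trans (normr_ge0 _) (dC x (Ordinal nd)).
  by rewrite ler_wpM2l// coord_le_norm.
by have := tel d (leqnn d); rewrite proj_first_full.
Qed.

Lemma ccyl_bounded_at0 (T : R) u : 0 <= T -> {within ccyl d T, continuous (uncur u)} ->
  exists M, forall s, 0 <= s <= T -> `|u s 0| <= M.
Proof.
move=> T0 cu.
(* The whole cylinder is not compact; its axis is. *)
pose K : set (R * 'rV[R]_d) := `[0, T]%classic `*` [set 0].
have cK : compact K by apply: compact_setX; [exact: segment_compact|exact: compact_set1].
have KC : K `<=` ccyl d T by move=> -[a b] [/= h _]; split.
have K0 : K !=set0 by exists (0, 0); split => //=; rewrite in_itv/= lexx.
have cn : {within K, continuous (fun p : R * 'rV[R]_d => `|uncur u p|)}.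
  by move=> p; apply: cvg_norm; exact: (continuous_subspaceW KC cu).
have [c _ hc] := compact_EVT_max K0 cK cn.
exists `|uncur u c| => s hs; apply: (hc (s, 0)); by rewrite inE.
Qed.

Lemma tderivable_right (T : R) u s x : 0 <= s < T -> tderivable T u s x ->
  (r - s)^-1 * (u r x - u s x) @[r --> s^'+] --> tderive T u s x.
Proof.
move=> /andP[s0 sT] h; apply: cvg_trans _ h => A.
rewrite /= => hA; have {hA} : (within `[0, T[ s^') (fun r => A (tquot u s x r)) by exact: hA.
rewrite /within /= => -[e /= e0 he].
change (\forall r \near s^'+, A ((r - s)^-1 * (u r x - u s x))).
near=> r; have sr : s < r by near: r; exact: nbhs_right_gt.
apply: he.
- rewrite /ball /= distrC gtr0_norm ?subr_gt0// ltrBlDr.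
  by near: r; apply: nbhs_right_lt; rewrite ltrDr.
- by rewrite gt_eqF.
- rewrite /= in_itv /= (le_trans s0 (ltW sr)) /=.
  by near: r; exact: nbhs_right_lt.
Unshelve. all: end_near. Qed.

(** The Caratheodory factorization of [f] at [g s] avoids dividing by increments of [g]
    that may vanish. *)
Lemma right_chain_rule (f : R -> R) (g : R -> R) (s a b : R) :
  is_derive (g s) 1 f a -> (r - s)^-1 * (g r - g s) @[r --> s^'+] --> b ->
  (r - s)^-1 * (f (g r) - f (g s)) @[r --> s^'+] --> a * b.
Proof.
move=> /is_derive1_caratheodory[q [q1 q2 <-]] h.
have g0 : g r @[r --> s^'+] --> g s.
  have h0 : (r - s) * ((r - s)^-1 * (g r - g s)) + g s @[r --> s^'+] --> (s - s) * b + g s.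
    apply: cvgD; last exact: cvg_cst.
    apply: cvgM h; apply: cvgB; last exact: cvg_cst.
    exact: cvg_at_right_filter.
  rewrite subrr mul0r add0r in h0; apply: cvg_trans h0; apply: near_eq_cvg.
  near=> r; have sr : s < r by near: r; exact: nbhs_right_gt.
  by rewrite mulrA divff ?mul1r ?subrK// subr_eq0 gt_eqF.
have qg : q (g r) @[r --> s^'+] --> q (g s) by exact: continuous_cvg.
apply: cvg_ext (cvgM qg h) => r; rewrite [LHS]/GRing.mul /=.
by rewrite q1 mulrCA.
Unshelve. all: end_near. Qed.

Definition cole_hopf (eps : R) u s x : R := expR (- u s x / eps).

Lemma cole_hopf_heat eps T g u s x : 0 < eps -> classical_solution T eps g u ->
  0 <= s < T -> heat_at eps (cole_hopf eps u) s x 0.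
Proof.
move=> e0 [[[_ dt _ dx _] dxx _] _ _ _ pde] hs.
pose E (z : R) := expR (- z / eps).
have dE (z : R) : is_derive z 1 E (- eps^-1 * E z).
  have := is_derive_expR_affine 0 (- eps^-1) z.
  rewrite (_ : (fun y => _) = E); last first.
    by apply/funext => y; rewrite /E add0r mulrN mulNr.
  by rewrite (_ : expR (0 + z * _) = E z)// /E add0r mulrN mulNr.
have ht := right_chain_rule (dE (u s x)) (tderivable_right hs (dt _ x hs)).
pose p i (y : R) := pderive i u s (x + y *: basis_vec R i).
pose pp i := pderive i (pderive i u) s x.
have dl i (y : R) : is_derive y 1 (fun y => u s (x + y *: basis_vec R i)) (p i y).
  by apply: pderive_line; exact: dx.
have dp i : is_derive (0 : R) 1 (p i) (pp i).
  have := @pderive_line i (pderive i u) s x 0.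
  by rewrite scale0r addr0; apply; exact: dxx.
exists (- eps^-1 * E (u s x) * tderive T u s x),
  (fun i y => - eps^-1 * E (u s (x + y *: basis_vec R i)) * p i y),
  (fun i => - eps^-1 * E (u s x) * pp i + eps^-1 ^+ 2 * E (u s x) * p i 0 ^+ 2).
split => //.
- by move=> i y; exact: is_derive1_comp (dE _) (dl i y).
- move=> i; have h1 := is_derive1_comp (dE (u s (x + 0 *: basis_vec R i))) (dl i 0).
  have := is_deriveM (is_deriveZ (- eps^-1) h1) (dp i) => /is_derive_eq; apply.
  rewrite /= (_ : E (u s (x + 0 *: basis_vec R i)) = E (u s x)); last first.
    by rewrite scale0r addr0.
  by rewrite /GRing.scale /=; ring.
rewrite big_split /= -!mulr_sumr.
have := pde s x hs; rewrite enorm_sqr.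
have -> : \sum_(i < d) grad u s x ord0 i ^+ 2 = \sum_(i < d) p i 0 ^+ 2.
  by apply: eq_bigr => i _; rewrite mxE /p scale0r addr0.
rewrite /laplacian -/(pp _); set S1 := \sum_(i < d) p i 0 ^+ 2.
rewrite (_ : \sum_(i < d) pderive i (pderive i u) s x = \sum_(i < d) pp i)//.
set S2 := \sum_(i < d) pp i; set b := tderive _ _ _ _ => h.
have {h} : b = 2^-1 * S1 - eps / 2 * S2 by lra.
by move=> ->; field; rewrite gt_eqF.
Qed.

Lemma cole_hopf_continuous eps T u : {within ccyl d T, continuous (uncur u)} ->
  {within ccyl d T, continuous (uncur (cole_hopf eps u))}.
Proof.
move=> cu p; apply: continuous_cvg; first exact: continuous_expR.
by apply: cvgMr_tmp; apply: cvgN; exact: cu.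
Qed.

(** The gradient bound gives linear growth in space before time [T]; at time [T] the
    linear growth is read off the explicit final value. *)
Lemma cole_hopf_growth eps T k u : 0 < eps -> 0 < T ->
  classical_solution T eps (@gterm R d k) u ->
  exists A c, 0 <= c /\ forall s x, 0 <= s <= T ->
    cole_hopf eps u s x <= A * expR (c * `|x|).
Proof.
move=> e0 T0 [[[_ _ _ dx _] _ _] [C gC] cu uT _].
have [M hM] := ccyl_bounded_at0 (ltW T0) cu.
pose C1 := `|C| + 1; have C10 : 0 <= C1 by rewrite addr_ge0.
exists (expR (M / eps)), (C1 * d%:R / eps); split.
  by rewrite divr_ge0 ?mulr_ge0// ltW.
move=> s x hs; rewrite -expRD ler_expR.
suff h : - u s x <= M + C1 * (d%:R * `|x|).
  have -> : M / eps + C1 * d%:R / eps * `|x| = (M + C1 * (d%:R * `|x|)) / eps by ring.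
  by rewrite ler_pM2r ?invr_gt0.
case/andP: (hs) => s0; rewrite le_eqVlt => /orP[/eqP sT|sT].
  rewrite sT uT /gterm opprK enorm_projE.
  have M0 : 0 <= M := le_trans (normr_ge0 _) (hM s hs).
  apply: ler_wpDl => //; apply: (@le_trans _ _ (d%:R * `|x|)); last first.
    by rewrite ler_peMl ?mulr_ge0// lerDr.
  exact: sqrt_sqnorm_first_le.
have hs' : 0 <= s < T by rewrite s0.
have gC1 y i : `|'D_(basis_vec R i) (u s) y| <= C1.
  have := coord_le_enorm (grad u s y) i; rewrite mxE => /le_trans; apply.
  by apply: (le_trans (gC s y hs')); rewrite (le_trans (ler_norm C))// lerDl.
have := lipschitz_of_pderive (fun y i => dx i s y hs') gC1 x.
rewrite ler_norml => /andP[h1 _].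
have := hM s hs; rewrite ler_norml => /andP[h2 _]; lra.
Qed.

(** Both bounds compare with the heat polynomials of the Taylor polynomials of
    [2 cosh(r / eps)].  For the lower bound any degree works, since these lie below
    [exp(r / eps) + 1] everywhere; for the upper bound the degree is taken large
    enough on the ball given by [heat_compare]. *)
Lemma cole_hopf_bounds eps T k u t : (0 < k)%N -> (k <= d)%N -> 0 < eps -> 0 < T ->
  classical_solution T eps (@gterm R d k) u -> 0 <= t < T ->
  2 * kummer k ((T - t) / eps) - 1 <= cole_hopf eps u t 0
    <= 2 * kummer k ((T - t) / eps).
Proof.
move=> k0 kd eps0 T0 sol ht.
have d0 : (0 < d)%N := leq_trans k0 kd.
have [t0 tT] := andP ht; have ht' : 0 <= t <= T by rewrite t0 ltW.
set z := (T - t) / eps.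
have z0 : 0 <= z by rewrite divr_ge0 ?subr_ge0 ?(ltW tT) ?ltW.
have cw : {within ccyl d T, continuous (uncur (cole_hopf eps u))}.
  by case: sol => _ _ cu _ _; exact: cole_hopf_continuous.
have wT x : cole_hopf eps u T x = expR (Num.sqrt (sqnorm_first k x) / eps).
  by case: sol => _ _ _ uT _; rewrite /cole_hopf uT /gterm opprK.
have chz := kummer_sum_is_cvg k0 z0.
pose P n : R -> 'rV[R]_d -> R := heat_poly k eps T n.+1 (cosh_poly eps n.+1).
have Pheat n s x : heat_at eps (P n) s x 0.
  by apply: heat_poly_heat => //; exact: size_poly.
have PT n x : P n T x = (cosh_poly eps n.+1).[Num.sqrt (sqnorm_first k x) ^+ 2].
  by rewrite /P heat_poly_end sqr_sqrtr ?sqnorm_first_ge0.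
have P0 n : P n t 0 = 2 * kummer_sum k z n.+1 by exact: heat_poly_cosh0.
apply/andP; split.
- suff hn n : 2 * kummer_sum k z n - 1 <= cole_hopf eps u t 0.
    have h : 2 * kummer_sum k z n - 1 @[n --> \oo] --> 2 * kummer k z - 1.
      by apply: cvgB; [exact: cvgMl_tmp|exact: cvg_cst].
    by apply: (ler_cvg_to h (cvg_cst _)); exact: nearW.
  apply: (@le_trans _ _ (2 * kummer_sum k z n.+1 - 1)).
    by rewrite lerB// ler_wpM2l// kummer_sum_ndecr.
  have [A hA] := @heat_poly_growth R d k eps T n.+1 (cosh_poly eps n.+1) (ltW eps0).
  have [K hK] := @heat_compare R d eps T A _ d0 eps0 T0 ler01.
  rewrite lerBlDr; apply: (@le_of_approx _ _ K) => e e0.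
  have [rho hrho] := hK e e0.
  pose v s x := (P n s x + (-1) * cole_hopf eps u s x) + (-1) * 1.
  suff : v t 0 <= e * K by rewrite /v P0 !mulN1r; lra.
  apply: hrho ht'.
  + apply: within_continuousD; last by apply: continuous_subspaceT => p; exact: cvg_cst.
    apply: within_continuousD.
      by apply: continuous_subspaceT; exact: heat_poly_continuous.
    by move=> p; apply: cvgMl_tmp; exact: cw.
  + move=> s x hs; rewrite mul1r; apply: le_trans (hA s x hs).
    by rewrite /v !mulN1r lerBlDr ler_wpDr// gerBl expR_ge0.
  + move=> s x hs; have := heat_at_lin (-1) (heat_at_lin (-1) (Pheat n s x)
      (cole_hopf_heat x eps0 sol hs)) (heat_at_cst eps s x 1).
    by congr heat_at; rewrite !mulr0 !addr0.
  + move=> x _; rewrite /v PT wT !mulN1r.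
    have := cosh_poly_le n.+1 eps0 (sqrtr_ge0 (sqnorm_first k x)); lra.
- have [A [c [c0 hA]]] := cole_hopf_growth eps0 T0 sol.
  have [K hK] := @heat_compare R d eps T A _ d0 eps0 T0 c0.
  apply: (@le_of_approx _ _ K) => e e0.
  have [rho hrho] := hK e e0.
  have [n hn] := cosh_poly_approx (Num.sqrt (d%:R * rho ^+ 2)) eps0 e0.
  pose v s x := cole_hopf eps u s x + (-1) * P n s x.
  have h : v t 0 <= e * K.
    apply: hrho ht'.
    + apply: within_continuousD => //.
      by apply: continuous_subspaceT => p; apply: cvgMl_tmp; exact: heat_poly_continuous.
    + move=> s x hs; apply: le_trans (hA s x hs); rewrite /v mulN1r gerBl.
      case/andP: hs => _ sT; apply: heat_poly_ge0 => //; first exact: ltW.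
      by move=> m; exact: cosh_poly_ge0.
    + move=> s x hs; have := heat_at_lin (-1) (cole_hopf_heat x eps0 sol hs) (Pheat n s x).
      by congr heat_at; rewrite mulr0 addr0.
    + move=> x xr; rewrite /v PT wT mulN1r lerBlDl addrC addrC; apply: hn.
      rewrite sqrtr_ge0 ler_wsqrtr//; apply: (le_trans (sqnorm_first_le k x)).
      by rewrite ler_wpM2l// lerXn2r ?nnegrE// (le_trans _ xr).
  apply: (@le_trans _ _ (2 * kummer_sum k z n.+1 + e * K)).
    by rewrite -lerBlDl -P0 -mulN1r.
  rewrite lerD2r ler_wpM2l//; apply: nondecreasing_cvgn_le => //.
  exact: kummer_sum_ndecr.
Qed.

End ColeHopf.

(** * The first-order equation *)

Section Viscosity.
Context {R : realType} {d : nat}.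
Implicit Types (x : 'rV[R]_d) (u psi : R -> 'rV[R]_d -> R).

(** Explicit formulas for the derivatives of a function that is smooth for all real
    times determine the derivatives relative to [0, T[. *)
Lemma C11_intro (T : R) psi (ft : R -> 'rV[R]_d -> R) (fi : 'I_d -> R -> 'rV[R]_d -> R) :
  continuous (uncur psi) ->
  (forall (s : R) x, is_derive s 1 (fun r : R => psi r x) (ft s x)) ->
  continuous (uncur ft) ->
  (forall i s x, is_derive (0 : R) 1 (fun y => psi s (x + y *: basis_vec R i)) (fi i s x)) ->
  (forall i, continuous (uncur (fi i))) ->
  [/\ C11 T psi, forall s x, 0 <= s < T -> tderive T psi s x = ft s x &
      forall i s x, pderive i psi s x = fi i s x].
Proof.
move=> cpsi dpsi cft dfi cfi.
have td s x : 0 <= s < T -> tderivable T psi s x.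
  move=> hs; apply/cvg_ex; exists (ft s x).
  have sh : (r - s) @[r --> s^'] --> 0^'.
    move=> A /nbhs_ballP[e /= e0 eA]; exists e => //= r rs rns.
    apply: eA; last by rewrite subr_eq0.
    by rewrite /ball /= sub0r normrN distrC.
  have h : tquot psi s x r @[r --> s^'] --> ft s x.
    by apply: cvg_ext (cvg_comp _ _ sh (is_derive_cvg (dpsi s x))) => r /=; rewrite subrK.
  exact: cvg_trans (cvg_app _ (@cvg_within _ _ _ _)) h.
have te s x : 0 <= s < T -> tderive T psi s x = ft s x.
  move=> hs; have h1 := tderivable_right hs (td s x hs).
  have h2 := is_derive_right_cvg (dpsi s x).
  by rewrite -(cvg_lim (@Rhausdorff R) h1) -(cvg_lim (@Rhausdorff R) h2).
have pd i s x : derivable (psi s) x (basis_vec R i) /\ pderive i psi s x = fi i s x.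
  have [h1 h2] := dfi i s x.
  have e : (fun h : R => h^-1 *: (psi s (x + (h *: 1 + 0) *: basis_vec R i) -
        psi s (x + 0 *: basis_vec R i))) =
      (fun h => h^-1 *: (psi s (h *: basis_vec R i + x) - psi s x)).
    apply/funext => h; congr (_ *: (psi s _ - psi s _)).
      by rewrite [h *: 1]mulr1 addr0 addrC.
    by rewrite scale0r addr0.
  by rewrite /derivable /pderive /derive -e -h2.
have pe i s x : pderive i psi s x = fi i s x by have [] := pd i s x.
split => //; split.
- exact: continuous_subspaceT.
- by move=> s x; exact: td.
- apply: (@subspace_eq_continuous _ _ _ (uncur ft)); last exact: continuous_subspaceT.
  by move=> [s x]; rewrite inE => -[/= + _]; rewrite in_itv/= => hs; symmetry; exact: te.
- by move=> i s x _; have [] := pd i s x.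
- move=> i; rewrite (_ : uncur (pderive i psi) = uncur (fi i)).
    exact: continuous_subspaceT.
  by apply/funext => -[s x]; exact: pe.
Qed.

(** No doubling of variables: a smooth strict supersolution is itself a test function
    at a maximum of the difference. *)
Lemma viscosity_le (T rho : R) u psi : 0 < T -> {within ccyl d T, continuous (uncur u)} ->
  viscosity_subsolution T u -> C11 T psi -> continuous (uncur psi) ->
  (forall x, u T x <= psi T x) ->
  (forall s x, 0 <= s <= T -> rho <= `|x| -> u s x <= psi s x) ->
  (forall s x, 0 <= s < T ->
     0 < - tderive T psi s x + 2^-1 * enorm (grad psi s x) ^+ 2) ->
  forall s x, 0 <= s <= T -> u s x <= psi s x.
Proof.
move=> T0 cu sub C11psi cpsi hT far strict s x hs.
rewrite -subr_le0 leNgt; apply/negP => pos.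
pose v r y := u r y - psi r y.
have cv : {within ccyl d T, continuous (uncur v)}.
  by apply: within_continuousB => //; exact: continuous_subspaceT.
have vT y : v T y <= 0 by rewrite subr_le0.
have vfar r y : 0 <= r <= T -> rho <= `|y| -> v r y <= 0.
  by move=> hr hy; rewrite subr_le0 far.
have [r [y [hr _ maxv]]] := exists_pos_max T0 cv vT vfar hs pos.
have : - tderive T psi r y + 2^-1 * enorm (grad psi r y) ^+ 2 <= 0.
  apply: sub => //; rewrite near_withinE; apply: nearW => -[r' y'] [/= + _].
  rewrite in_itv/= => /andP[r0 rT]; apply: maxv; rewrite r0 ltW//.
by apply/negP; rewrite -ltNge strict.
Qed.

Lemma viscosity_ge (T rho : R) u psi : 0 < T -> {within ccyl d T, continuous (uncur u)} ->
  viscosity_supersolution T u -> C11 T psi -> continuous (uncur psi) ->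
  (forall x, psi T x <= u T x) ->
  (forall s x, 0 <= s <= T -> rho <= `|x| -> psi s x <= u s x) ->
  (forall s x, 0 <= s < T ->
     - tderive T psi s x + 2^-1 * enorm (grad psi s x) ^+ 2 < 0) ->
  forall s x, 0 <= s <= T -> psi s x <= u s x.
Proof.
move=> T0 cu sup C11psi cpsi hT far strict s x hs.
rewrite -subr_le0 leNgt; apply/negP => pos.
pose v r y := psi r y - u r y.
have cv : {within ccyl d T, continuous (uncur v)}.
  by apply: within_continuousB => //; exact: continuous_subspaceT.
have vT y : v T y <= 0 by rewrite subr_le0.
have vfar r y : 0 <= r <= T -> rho <= `|y| -> v r y <= 0.
  by move=> hr hy; rewrite subr_le0 far.
have [r [y [hr _ maxv]]] := exists_pos_max T0 cv vT vfar hs pos.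
have : 0 <= - tderive T psi r y + 2^-1 * enorm (grad psi r y) ^+ 2.
  apply: sup => //; rewrite near_withinE; apply: nearW => -[r' y'] [/= + _].
  rewrite in_itv/= => /andP[r0 rT].
  have := maxv r' y'; rewrite r0 (ltW rT) => /(_ isT).
  by rewrite /v -lerN2 !opprB.
by apply/negP; rewrite -ltNge strict.
Qed.

(** Every test function has this shape: [a] carries the behaviour of the final value,
    [- (T - s) / 2] is the exact time dependence, and the last term is the perturbation
    that provides strictness and dominates at infinity. *)
Definition test_fun (T lam c : R) (a : 'rV[R]_d -> R) (s : R) x : R :=
  a x - (T - s) / 2 + c * ((1 + sqnorm_first d x) * expR (lam * (T - s))).

Lemma test_fun_C11 (T lam c : R) a (ai : 'I_d -> 'rV[R]_d -> R) :
  continuous a -> (forall i, continuous (ai i)) ->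
  (forall i x, is_derive (0 : R) 1 (fun y => a (x + y *: basis_vec R i)) (ai i x)) ->
  [/\ continuous (uncur (test_fun T lam c a)), C11 T (test_fun T lam c a) &
   forall s x, 0 <= s < T ->
     - tderive T (test_fun T lam c a) s x +
       2^-1 * enorm (grad (test_fun T lam c a) s x) ^+ 2 =
     2^-1 * (\sum_i ai i x ^+ 2 - 1) + c * expR (lam * (T - s)) *
       (lam * (1 + sqnorm_first d x) + 2 * \sum_i ai i x * x ord0 i
        + 2 * c * expR (lam * (T - s)) * sqnorm_first d x)].
Proof.
move=> ca cai da.
pose E (s : R) := expR (lam * (T - s)).
have cE : continuous (fun p : R * 'rV[R]_d => expR (lam * (T - p.1))).
  move=> p; apply: continuous_cvg; first exact: continuous_expR.
  by apply: cvgMl_tmp; apply: cvgB; [exact: cvg_cst|exact: cvg_fst].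
have cQ : continuous (fun p : R * 'rV[R]_d => 1 + sqnorm_first d p.2).
  move=> p; apply: cvgD; first exact: cvg_cst.
  by apply: (cvg_comp snd (sqnorm_first d)); [exact: cvg_snd|exact: continuous_sqnorm_first].
have cpsi : continuous (uncur (test_fun T lam c a)).
  move=> p; apply: cvgD; last by apply: cvgMl_tmp; exact: (cvgM (cQ p) (cE p)).
  apply: cvgB; first by apply: (cvg_comp snd a); [exact: cvg_snd|exact: ca].
  by apply: cvgMr_tmp; apply: cvgB; [exact: cvg_cst|exact: cvg_fst].
pose ft (s : R) x := 2^-1 - lam * c * ((1 + sqnorm_first d x) * E s).
pose fi i (s : R) x := ai i x + 2 * c * (x ord0 i * E s).
have dE (s : R) : is_derive s 1 E (- lam * E s).
  have := is_derive_expR_affine (lam * T) (- lam) s.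
  rewrite (_ : (fun y => _) = E); last first.
    by apply/funext => r; rewrite /E; congr expR; ring.
  by move/is_derive_eq; apply; rewrite /E; congr (_ * expR _); ring.
have dft (s : R) x : is_derive s 1 (fun r : R => test_fun T lam c a r x) (ft s x).
  have := is_deriveD (is_derive_affine (a x - T / 2) 2^-1 s)
    (is_deriveZ (c * (1 + sqnorm_first d x)) (dE s)).
  rewrite (_ : _ + _ = (fun r : R => test_fun T lam c a r x)); last first.
    by apply/funext => r; rewrite /test_fun [LHS]/GRing.add /= /GRing.scale /= -/(E r); ring.
  by move/is_derive_eq; apply; rewrite /ft /GRing.scale /=; ring.
have dfi i (s : R) x : is_derive (0 : R) 1
    (fun y => test_fun T lam c a s (x + y *: basis_vec R i)) (fi i s x).
  have h1 := is_deriveD (is_derive_affine (1 + sqnorm_first d x) (2 * x ord0 i) 0) (is_derive_expn 2 0).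
  have h2 := is_deriveD (da i x) (is_derive_cst (- ((T - s) / 2)) (0 : R) (1 : R)).
  have h3 : is_derive (0 : R) 1 (fun y : R => a (x + y *: basis_vec R i) + - ((T - s) / 2) +
      c * E s * (1 + sqnorm_first d x + y * (2 * x ord0 i) + y ^+ 2)) _ :=
    is_deriveD h2 (is_deriveZ (c * E s) h1).
  rewrite (_ : (fun _ => _) = (fun y => test_fun T lam c a s (x + y *: basis_vec R i))) in h3.
    by move/is_derive_eq : h3; apply; rewrite /fi /GRing.scale /=; ring.
  apply/funext => y; rewrite /test_fun sqnorm_first_line ltn_ord -/(E s) mulr1n.
  by move: (a _) (E s) => a1 e1; ring.
have cft : continuous (uncur ft).
  move=> p; apply: cvgB; first exact: cvg_cst.
  by apply: cvgMl_tmp; exact: (cvgM (cQ p) (cE p)).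
have cfi i : continuous (uncur (fi i)).
  move=> p; apply: cvgD; first by apply: (cvg_comp snd (ai i)); [exact: cvg_snd|exact: cai].
  apply: cvgMl_tmp; exact: (cvgM (@continuous_coord_snd R d i p) (cE p)).
have [h1 h2 h3] := C11_intro T cpsi dft cft dfi cfi.
split => // s x hs; rewrite h2// enorm_sqr.
have -> : \sum_(i < d) grad (test_fun T lam c a) s x ord0 i ^+ 2 =
    \sum_i ai i x ^+ 2 + 4 * c * E s * (\sum_i ai i x * x ord0 i)
    + 4 * c ^+ 2 * E s ^+ 2 * sqnorm_first d x.
  rewrite sqnorm_firstE !mulr_sumr -!big_split /=; apply: eq_bigr => i _.
  by rewrite mxE h3 /fi ltn_ord mulr1n; move: (E s) => e1; ring.
by rewrite /ft -/(E s); field.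
Qed.

Lemma sqr_norm_le_sqnorm_first x : (0 < d)%N -> `|x| ^+ 2 <= sqnorm_first d x.
Proof.
move=> d0; have [i ->] := norm_attained x d0.
rewrite real_normK ?num_real// sqnorm_firstE (bigD1 i)//= ltn_ord mul1r lerDl.
by apply: sumr_ge0 => j _; rewrite mulr_ge0 ?sqr_ge0.
Qed.

Lemma viscosity_linear_growth (T : R) g u : 0 < T -> viscosity_solution T g u ->
  exists M C : R, [/\ 0 <= M, 0 <= C &
    forall s x, 0 <= s <= T -> `|u s x| <= M + C * `|x|].
Proof.
move=> T0 [cu [L hL] _ _ _].
have [M hM] := ccyl_bounded_at0 (ltW T0) cu.
exists M, (`|L| * d%:R); split.
- by apply: (le_trans (normr_ge0 _) (hM 0 _)); rewrite lexx ltW.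
- by rewrite mulr_ge0.
move=> s x hs; rewrite -(subrK (u s 0) (u s x)) addrC.
apply: (le_trans (ler_normD _ _)); rewrite lerD ?hM//.
apply: (le_trans (hL s x 0 hs)); rewrite subr0 -mulrA.
apply: (@le_trans _ _ (`|L| * enorm x)).
  by rewrite ler_wpM2r ?sqrtr_ge0 ?ler_norm.
by rewrite ler_wpM2l// -{1}(proj_first_full x) enorm_projE sqrt_sqnorm_first_le.
Qed.

Lemma quadratic_dominates (A B e r : R) : 0 < e -> 0 <= A -> 0 <= B ->
  1 + (A + B) / e <= r -> A + B * r <= e * r ^+ 2.
Proof.
move=> e0 A0 B0 hr.
have AB : 0 <= (A + B) / e by rewrite divr_ge0 ?addr_ge0// ltW.
have r1 : 1 <= r by lra.
have : A + B <= e * r by rewrite -ler_pdivrMl// mulrC; lra.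
by rewrite expr2; nra.
Qed.

(** The affine function [- x_0 - (T - s) / 2] is an exact solution lying above [- r] at time
    [T] and taking the value [- (T - s) / 2] at the origin. *)
Lemma hopf_lax_le (T : R) k u : (0 < k)%N -> (k <= d)%N -> 0 < T ->
  viscosity_solution T (@gterm R d k) u ->
  forall t, 0 <= t < T -> u t 0 <= - ((T - t) / 2).
Proof.
move=> k0 kd T0 sol t /andP[t0 tT].
have d0 : (0 < d)%N := leq_trans k0 kd.
have [M [C [M0 C0 growth]]] := viscosity_linear_growth T0 sol.
case: sol => cu _ uT sub _.
pose i0 := Ordinal d0.
pose a x := - x ord0 i0.
pose ai (i : 'I_d) x : R := - (i == i0)%:R.
have ca : continuous a.
  move=> x; have h : {for x, continuous (fun y : 'rV[R]_d => y ord0 i0)}.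
    exact: coord_continuous.
  exact: (cvgN h).
have cai i : continuous (ai i) by exact: cst_continuous.
have da i x : is_derive (0 : R) 1 (fun y => a (x + y *: basis_vec R i)) (ai i x).
  rewrite (_ : (fun y => _) = (fun y => a x + y * ai i x)).
    exact: is_derive_affine.
  by apply/funext => y; rewrite /a line_coord /ai; ring.
apply: (@le_of_approx _ _ _ (expR (3 * (T - t)))) => e e0.
have [cpsi C11psi op] := test_fun_C11 T 3 e ca cai da.
have abs_le x : 2 * `|x ord0 i0| <= 1 + sqnorm_first d x.
  have : x ord0 i0 ^+ 2 <= sqnorm_first d x.
    rewrite sqnorm_firstE (bigD1 i0)//= d0 mul1r lerDl.
    by apply: sumr_ge0 => j _; rewrite mulr_ge0 ?sqr_ge0.
  rewrite -(real_normK (num_real (x ord0 i0))); have := sqr_ge0 (`|x ord0 i0| - 1); nra.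
have := @viscosity_le T (1 + ((M + T / 2) + (C + 1)) / e) u _ T0 cu sub C11psi cpsi.
have {}hE s : s <= T -> 1 <= expR (3 * (T - s)).
  by move=> sT; rewrite -expR0 ler_expR mulr_ge0// subr_ge0.
move=> /(_ _ _ _ t 0) main.
have : u t 0 <= test_fun T 3 e a t 0.
  apply: main => [x|s x hs hx|s x hs|]; last by rewrite t0 ltW.
  - rewrite uT /gterm enorm_projE /test_fun subrr mul0r subr0 /a.
    apply: ler_wpDr; first by rewrite !mulr_ge0 ?expR_ge0 ?addr_ge0 ?sqnorm_first_ge0 ?(ltW e0).
    rewrite lerN2; apply: (le_trans (ler_norm _)); rewrite -sqrtr_sqr ler_wsqrtr//.
    rewrite sqnorm_firstE (bigD1 i0)//= k0 mul1r lerDl.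
    by apply: sumr_ge0 => j _; rewrite mulr_ge0 ?sqr_ge0.
  - apply: (le_trans (ler_norm _)); apply: (le_trans (growth s x hs)).
    have T20 : 0 <= T / 2 by rewrite divr_ge0// ltW.
    have := quadratic_dominates e0 (addr_ge0 M0 T20) (addr_ge0 C0 ler01) hx.
    have q1 := sqr_norm_le_sqnorm_first x d0.
    have [s0 sT] := andP hs; have E1 := hE s sT.
    have x1 := coord_le_norm x i0; have x2 := ler_norm (x ord0 i0).
    have : e * `|x| ^+ 2 <= e * ((1 + sqnorm_first d x) * expR (3 * (T - s))).
      rewrite ler_wpM2l ?(ltW e0)//; apply: (le_trans q1).
      have := sqnorm_first_ge0 d x; nra.
    rewrite /test_fun /a; lra.
  - rewrite op//.
    have -> : \sum_i ai i x ^+ 2 = 1.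
      rewrite (bigD1 i0)//= /ai eqxx sqrrN expr1n big1 ?addr0//.
      by move=> i /negbTE ->; rewrite oppr0 expr0n.
    have -> : \sum_i ai i x * x ord0 i = - x ord0 i0.
      rewrite (bigD1 i0)//= /ai eqxx mulN1r big1 ?addr0//.
      by move=> i /negbTE ->; rewrite oppr0 mul0r.
    rewrite subrr mulr0 add0r mulr_gt0 ?mulr_gt0 ?expR_gt0//.
    have h1 := abs_le x; have h2 := ler_norm (x ord0 i0); have h3 := sqnorm_first_ge0 d x.
    have : 0 <= 2 * e * expR (3 * (T - s)) * sqnorm_first d x.
      by rewrite !mulr_ge0 ?expR_ge0 ?(ltW e0).
    lra.
rewrite /test_fun sqnorm_first0 addr0 mul1r /a mxE; lra.
Qed.

(** The concave function [- sqrt(eta^2 + r^2) - (T - s) / 2] has gradient of norm at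
    most [1], so it is a subsolution, and lies below [- r] at time [T]. *)
Lemma hopf_lax_ge (T : R) k u : (0 < k)%N -> (k <= d)%N -> 0 < T ->
  viscosity_solution T (@gterm R d k) u ->
  forall t, 0 <= t < T -> - ((T - t) / 2) <= u t 0.
Proof.
move=> k0 kd T0 sol t /andP[t0 tT].
have d0 : (0 < d)%N := leq_trans k0 kd.
have [M [C [M0 C0 growth]]] := viscosity_linear_growth T0 sol.
case: sol => cu _ uT _ sup.
have hE s : s <= T -> 1 <= expR (3 * (T - s)).
  by move=> sT; rewrite -expR0 ler_expR mulr_ge0// subr_ge0.
apply: (@le_of_approx _ _ _ (1 + expR (3 * (T - t)))) => eta eta0.
pose S x := Num.sqrt (eta ^+ 2 + sqnorm_first k x).
have arg0 x : 0 < eta ^+ 2 + sqnorm_first k x by rewrite ltr_pwDl ?sqnorm_first_ge0// exprn_gt0.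
have S0 x : 0 < S x by rewrite sqrtr_gt0.
have SS x : S x ^+ 2 = eta ^+ 2 + sqnorm_first k x by rewrite sqr_sqrtr// ltW.
pose a x := - S x.
pose ai (i : 'I_d) x : R := - ((i < k)%:R * x ord0 i / S x).
have cS : continuous S.
  move=> x; have h : {for x, continuous (fun y => eta ^+ 2 + sqnorm_first k y)}.
    exact: (cvgD (cvg_cst _) (@continuous_sqnorm_first R d k x)).
  by apply: (continuous_comp h); exact: sqrt_continuous.
have ca : continuous a by move=> x; exact: (cvgN (cS x)).
have cai i : continuous (ai i).
  move=> x; have h : {for x, continuous (fun y : 'rV[R]_d => y ord0 i)}.
    exact: coord_continuous.
  have hV : (S y)^-1 @[y --> x] --> (S x)^-1 by apply: cvgV (cS x); rewrite gt_eqF.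
  have hb : {for x, continuous (fun y : 'rV[R]_d => (i < k)%:R * y ord0 i)}.
    exact: (cvgMl_tmp h).
  exact: (cvgN (cvgM hb hV)).
have da i x : is_derive (0 : R) 1 (fun y => a (x + y *: basis_vec R i)) (ai i x).
  pose b : R := (i < k)%:R.
  have h1 := is_deriveD (is_derive_affine (eta ^+ 2 + sqnorm_first k x) (b * (2 * x ord0 i)) 0)
    (is_deriveZ b (is_derive_expn 2 0)).
  pose q (y : R) := eta ^+ 2 + sqnorm_first k x + y * (b * (2 * x ord0 i)) + b * y ^+ 2.
  have {}h1 : is_derive (0 : R) 1 q (b * (2 * x ord0 i)).
    by move/is_derive_eq : h1; apply; rewrite /GRing.scale /=; ring.
  have q0 : q 0 = eta ^+ 2 + sqnorm_first k x by rewrite /q; ring.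
  have q0' : 0 < q 0 by rewrite q0.
  have h2 := is_deriveN (is_derive1_comp (is_derive1_sqrt q0') h1).
  rewrite (_ : (fun y => _) = - (Num.sqrt \o q)).
    move/is_derive_eq : h2; apply; rewrite /ai q0 -/(S x) -/b.
    by field; rewrite gt_eqF.
  apply/funext => y; rewrite /a /S sqnorm_first_line /q; congr (- Num.sqrt _).
  by rewrite -/b; ring.
(* Below the second bound the quadratic term of the perturbed gradient is absorbed. *)
pose e := Num.min eta (2 * expR (3 * T))^-1.
have e0 : 0 < e by rewrite lt_min eta0 invr_gt0 mulr_gt0 ?expR_gt0.
have eeta : e <= eta by rewrite ge_min lexx.
have eE s : 0 <= s -> 2 * e * expR (3 * (T - s)) <= 1.
  move=> s0; have h1 : e <= (2 * expR (3 * T))^-1 by rewrite ge_min lexx orbT.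
  have h2 : expR (3 * (T - s)) <= expR (3 * T) by rewrite ler_expR; lra.
  have E0 := expR_gt0 (3 * T).
  apply: (@le_trans _ _ (2 * (2 * expR (3 * T))^-1 * expR (3 * T))); last first.
    by rewrite invfM mulrA divff// mul1r mulVf// gt_eqF.
  by rewrite ler_pM ?mulr_ge0 ?expR_ge0 ?(ltW e0)// ler_wpM2l.
have [cpsi C11psi op] := test_fun_C11 T 3 (- e) ca cai da.
have := @viscosity_ge T (1 + (M + C) / e) u _ T0 cu sup C11psi cpsi.
move=> /(_ _ _ _ t 0) main.
have : test_fun T 3 (- e) a t 0 <= u t 0.
  apply: main => [x|s x hs hx|s x hs|]; last by rewrite t0 ltW.
  - rewrite uT /gterm enorm_projE /test_fun subrr mul0r subr0 /a mulNr lerBlDr.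
    apply: ler_wpDr; first by rewrite !mulr_ge0 ?expR_ge0 ?addr_ge0 ?sqnorm_first_ge0 ?(ltW e0).
    by rewrite lerN2 ler_wsqrtr// lerDr sqr_ge0.
  - have := growth s x hs; rewrite ler_norml => /andP[h1 _]; apply: le_trans h1.
    have := quadratic_dominates e0 M0 C0 hx.
    have q1 := sqr_norm_le_sqnorm_first x d0.
    have [s0 sT] := andP hs; have E1 := hE s sT.
    have : e * `|x| ^+ 2 <= e * ((1 + sqnorm_first d x) * expR (3 * (T - s))).
      rewrite ler_wpM2l ?(ltW e0)//; apply: (le_trans q1).
      have := sqnorm_first_ge0 d x; nra.
    rewrite /test_fun /a mulNr; have := S0 x; lra.
  - rewrite op//; have [s0 sT] := andP hs.
    have sum1 : \sum_i ai i x ^+ 2 = sqnorm_first k x / S x ^+ 2.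
      rewrite sqnorm_firstE mulr_suml; apply: eq_bigr => i _; rewrite /ai sqrrN.
      by case: (i < k)%N; rewrite ?mulr1n ?mulr0n ?mul1r ?mul0r ?expr0n// expr_div_n.
    have sum2 : \sum_i ai i x * x ord0 i = - (sqnorm_first k x / S x).
      rewrite sqnorm_firstE mulr_suml -sumrN; apply: eq_bigr => i _; rewrite /ai.
      by rewrite mulNr expr2; congr (- _); ring.
    have pk := sqnorm_first_ge0 k x; have pd := sqnorm_first_ge0 d x.
    have pkd : sqnorm_first k x <= sqnorm_first d x.
      rewrite !sqnorm_firstE; apply: ler_sum => i _; rewrite ltn_ord ler_wpM2r ?sqr_ge0//.
      by rewrite lern1 leq_b1.
    have le1 : \sum_i ai i x ^+ 2 <= 1.
      by rewrite sum1 ler_pdivrMr ?exprn_gt0// mul1r SS lerDr sqr_ge0.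
    have le2 : 2 * (sqnorm_first k x / S x) <= 1 + sqnorm_first d x.
      have w2 : (sqnorm_first k x / S x) ^+ 2 <= sqnorm_first k x.
        rewrite expr_div_n ler_pdivrMr ?exprn_gt0// SS expr2 ler_wpM2l//.
        by rewrite lerDr sqr_ge0.
      have := sqr_ge0 (sqnorm_first k x / S x - 1); nra.
    have le3 := eE s s0.
    have E0 := expR_gt0 (3 * (T - s)).
    have eE0 : 0 < e * expR (3 * (T - s)) by rewrite mulr_gt0.
    rewrite sum2.
    have : 0 < 3 * (1 + sqnorm_first d x) + 2 * - (sqnorm_first k x / S x) +
        2 * - e * expR (3 * (T - s)) * sqnorm_first d x.
      have : 2 * e * expR (3 * (T - s)) * sqnorm_first d x <= sqnorm_first d x.
        by rewrite -[leRHS]mul1r ler_wpM2r.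
      lra.
    move: (3 * (1 + sqnorm_first d x) + _ + _) => X X0.
    have := mulr_gt0 eE0 X0; rewrite mulNr mulNr; lra.
rewrite /test_fun sqnorm_first0 addr0 mul1r /a /S sqnorm_first0 addr0 sqrtr_sqr gtr0_norm// mulNr.
have : e * expR (3 * (T - t)) <= eta * expR (3 * (T - t)).
  by rewrite ler_wpM2r ?expR_ge0.
lra.
Qed.

End Viscosity.

(** * The expansion *)

Lemma cvg_invr_right0 (R : realType) (a : R) : 0 < a ->
  a / x @[x --> 0^'+] --> (+oo : set_system R).
Proof.
move=> a0; apply: gt0_cvgMry => //; apply/gtr0_cvgV0.
  by near=> x; rewrite invr_gt0; near: x; exact: nbhs_right_gt.
rewrite [X in X @ _](_ : _ = id); last by apply/funext => x; exact: invrK.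
exact: cvg_at_right_filter.
Unshelve. all: end_near. Qed.

(** The error [1] of [cole_hopf_bounds] is divided by a quantity that is at least
    [(T - t) / (2 eps)] when [eps <= T - t]. *)
Lemma cole_hopf_ratio_cvg (R : realType) (d k : nat) (T t : R)
    (phi : R -> R -> 'rV[R]_d -> R) : (0 < k)%N -> (k <= d)%N -> 0 < T ->
  (forall eps : R, 0 < eps <= 1 -> classical_solution T eps (@gterm R d k) (phi eps)) ->
  0 <= t < T ->
  cole_hopf eps (phi eps) t 0 /
    (((T - t) / eps) `^ ((k%:R - 1) / 2) * expR ((T - t) / eps / 2))
  @[eps --> 0^'+] --> expansion_const k.
Proof.
move=> k0 kd T0 sol /[dup] ht /andP[t0 tT].
have tau0 : 0 < T - t by rewrite subr_gt0.
have zy := cvg_invr_right0 tau0.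
have up : 2 * kummer_ratio k ((T - t) / eps) @[eps --> 0^'+] --> expansion_const k.
  exact: (cvg_comp _ _ zy (@kummer_ratio_cvg R k k0)).
have zV : ((T - t) / eps / 2)^-1 @[eps --> 0^'+] --> (0 : R).
  apply/gtr0_cvgV0; last by apply: gt0_cvgMly => //; rewrite invr_gt0.
  near=> eps; rewrite !divr_gt0//; near: eps; exact: nbhs_right_gt.
have lo : 2 * kummer_ratio k ((T - t) / eps) - ((T - t) / eps / 2)^-1 @[eps --> 0^'+]
    --> expansion_const k.
  by rewrite -[X in _ --> X]subr0; exact: cvgB.
apply: squeeze_cvgr lo up; near=> eps.
have e0 : 0 < eps by near: eps; exact: nbhs_right_gt.
have e1 : eps <= 1 by near: eps; apply: nbhs_right_le.
have et : eps <= T - t by near: eps; apply: nbhs_right_le.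
have heps : 0 < eps <= 1 by rewrite e0.
have /andP[h1 h2] := cole_hopf_bounds k0 kd e0 T0 (sol eps heps) ht.
rewrite /kummer_ratio; set z := (T - t) / eps in h1 h2 *.
have z1 : 1 <= z by rewrite ler_pdivlMr// mul1r.
have P1 : 1 <= z `^ ((k%:R - 1) / 2).
  by rewrite -[leLHS](powRr0 z) ler_powR// divr_ge0// subr_ge0 ler1n.
have E0 := expR_gt0 (z / 2).
have D0 : 0 < z `^ ((k%:R - 1) / 2) * expR (z / 2) by apply: mulr_gt0 => //; exact: (lt_le_trans ltr01 P1).
apply/andP; split; last by rewrite mulrA ler_pM2r ?invr_gt0.
have z20 : 0 < z / 2 by rewrite divr_gt0// (lt_le_trans ltr01 z1).
have D1 : 1 <= (z / 2)^-1 * (z `^ ((k%:R - 1) / 2) * expR (z / 2)).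
  rewrite ler_pdivlMl// mulr1; apply: (@le_trans _ _ (expR (z / 2))).
    by apply: le_trans (expR_ge1Dx _); rewrite lerDr.
  by rewrite ler_peMl// ltW.
rewrite ler_pdivlMr// mulrBl mulrA divfK ?gt_eqF//.
by apply: le_trans h1; rewrite lerB.
Unshelve. all: end_near. Qed.

Theorem proposition3p1 (R : realType) (d k : nat)
    (hd : (1 <= d)%N) (hk : (1 <= k)%N) (hkd : (k <= d)%N)
    (T : R) (hT : 0 < T)
    (phi : R -> R -> 'rV[R]_d -> R) (phi0 : R -> 'rV[R]_d -> R)
    (hphi : forall eps : R, 0 < eps <= 1 ->
       classical_solution T eps (@gterm R d k) (phi eps))
    (hphi0 : viscosity_solution T (@gterm R d k) phi0)
    (t : R) (ht : 0 <= t < T) :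
  (fun eps : R => phi eps t 0) =
  (fun eps : R => phi0 t 0
     + (k%:R - 1) / 2 * eps * ln eps
     - (k%:R - 1) / 2 * eps * ln (T - t)
     - eps * ln (k%:R * Num.sqrt pi /
                 (2 `^ ((k%:R - 1) / 2) * Gamma (k%:R / 2 + 1))))
  +o_ (0^'+) (fun eps : R => eps).
Proof.
have tau0 : 0 < T - t by case/andP: ht => _; rewrite subr_gt0.
have phi0E : phi0 t 0 = - ((T - t) / 2).
  by apply/eqP; rewrite eq_le (hopf_lax_le hk hkd hT hphi0 ht) (hopf_lax_ge hk hkd hT hphi0 ht).
rewrite -/(expansion_const k) phi0E; have c0 := @expansion_const_gt0 R k hk.
have lnr : ln (cole_hopf eps (phi eps) t 0 /
    (((T - t) / eps) `^ ((k%:R - 1) / 2) * expR ((T - t) / eps / 2)))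
    @[eps --> 0^'+] --> ln (expansion_const k).
  apply: continuous_cvg; first exact: continuous_ln.
  exact: cole_hopf_ratio_cvg hk hkd hT hphi ht.
move/cvgrPdist_le : lnr => lnr.
apply/eqaddoP => e e0; have {}lnr := lnr e e0.
near=> eps.
have eps0 : 0 < eps by near: eps; exact: nbhs_right_gt.
have : `|ln (expansion_const k) - ln (cole_hopf eps (phi eps) t 0 /
    (((T - t) / eps) `^ ((k%:R - 1) / 2) * expR ((T - t) / eps / 2)))| <= e.
  by near: eps; exact: lnr.
have z0 : 0 < (T - t) / eps by rewrite divr_gt0.
rewrite ln_div ?posrE ?mulr_gt0 ?expR_gt0 ?powR_gt0//.
rewrite lnM ?posrE ?expR_gt0 ?powR_gt0// ln_powR /cole_hopf !expRK.
rewrite ln_div ?posrE// => h.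
rewrite [X in `|X|](_ : _ = eps * (ln (expansion_const k) - (- phi eps t 0 / eps -
    ((k%:R - 1) / 2 * (ln (T - t) - ln eps) + (T - t) / eps / 2)))).
  by rewrite normrM mulrC ler_wpM2r.
transitivity (phi eps t 0 - (- ((T - t) / 2) + (k%:R - 1) / 2 * eps * ln eps
  - (k%:R - 1) / 2 * eps * ln (T - t) - eps * ln (expansion_const k))); first by [].
by field; rewrite gt_eqF.
Unshelve. all: end_near. Qed.
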